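(* Let $\lambda/\mu$ be a skew shape (partitions $\mu\subseteq\lambda$). Then $$\sum_{\pi\in\mathrm{RPP}(\lambda/\mu)}q^{|\pi|}\;=\;\sum_{D\in\mathcal{E}(\lambda/\mu)}q^{a'(D)}\prod_{u\in[\lambda]\setminus D}\frac{1}{1-q^{h(u)}},$$ where $a'(D)=\sum_{u\in\Lambda(D)}h(u)$ and $\Lambda(D)$ is the set of excited peaks of $D$.
   Context: $[\lambda]=\{(i,j):1\le i\le \ell(\lambda),\,1\le j\le\lambda_i\}$ is the Young diagram (rows numbered from the top, columns from the left), $\lambda'$ is the conjugate partition, and $h(i,j)=\lambda_i-i+\lambda'_j-j+1$ is the hook-length in $\lambda$. $\mathrm{RPP}(\lambda/\mu)$ is the set of reverse plane partitions of shape $\lambda/\mu$: fillings $\pi$ of $[\lambda]\setminus[\mu]$ with nonnegative integers, weakly increasing along rows and down columns; $|\pi|$ is the sum of the entries. Excited diagrams: for $D\subseteq[\lambda]$, a cell $u=(i,j)\in D$ is active if $(i+1,j)$, $(i,j+1)$, $(i+1,j+1)$ all lie in $[\lambda]\setminus D$; the excited move $\alpha_u$ at an active cell $u=(i,j)$ replaces $(i,j)$ in $D$ by $(i+1,j+1)$. $\mathcal{E}(\lambda/\mu)$ is the set of all subsets of $[\lambda]$ obtained from $[\mu]$ by a (possibly empty) sequence of excited moves. Excited peaks: to each $D\in\mathcal{E}(\lambda/\mu)$ is associated a subset $\Lambda(D)\subseteq[\lambda]\setminus D$, defined by $\Lambda([\mu])=\varnothing$ and, for an active cell $u=(i,j)$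 of $D$, $\Lambda(\alpha_u(D))=\bigl(\Lambda(D)\setminus\{(i,j+1),(i+1,j)\}\bigr)\cup\{u\}$ (this does not depend on the sequence of excited moves used to reach $D$). *)

(* Defs.v *)
From HB Require Import structures.
From mathcomp Require Import all_boot all_order all_algebra.
From mathcomp Require Import finmap boolp classical_sets functions cardinality.
From mathcomp Require Import fsbigop.

Set Implicit Arguments.
Unset Strict Implicit.
Unset Printing Implicit Defensive.

Import Order.TTheory GRing.Theory Num.Theory.

Local Open Scope ring_scope.

Record fps (R : Type) := FPS { fps_coef : nat -> R }.

HB.instance Definition _ (R : Type) := [isNew for @fps_coef R].
HB.instance Definition _ (R : choiceType) := [Choice of fps R by <:].

Section FpsRing.
Variable R : comNzRingType.
Implicit Types f g h : fps R.

Lemma fpsP f g : fps_coef f =1 fps_coef g -> f = g.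
Proof. by case: f g => [f] [g] /= /funext ->. Qed.

Definition fps0 : fps R := FPS (fun=> 0).
Definition fps_opp f : fps R := FPS (fun n => - fps_coef f n).
Definition fps_add f g : fps R := FPS (fun n => fps_coef f n + fps_coef g n).
Definition fps1 : fps R := FPS (fun n => (n == 0%N)%:R).
Definition fps_mul f g : fps R :=
  FPS (fun n => \sum_(k < n.+1) fps_coef f k * fps_coef g (n - k)%N).

Fact fps_addA : associative fps_add.
Proof. by move=> f g h; apply: fpsP => n /=; rewrite addrA. Qed.
Fact fps_addC : commutative fps_add.
Proof. by move=> f g; apply: fpsP => n /=; rewrite addrC. Qed.
Fact fps_add0 : left_id fps0 fps_add.
Proof. by move=> f; apply: fpsP => n /=; rewrite add0r. Qed.
Fact fps_addN : left_inverse fps0 fps_opp fps_add.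
Proof. by move=> f; apply: fpsP => n /=; rewrite addNr. Qed.

HB.instance Definition _ :=
  GRing.isZmodule.Build (fps R) fps_addA fps_addC fps_add0 fps_addN.

Let trunc N f : {poly R} := \poly_(i < N) fps_coef f i.

Fact fps_mul_trunc N f g n : (n < N)%N ->
  fps_coef (fps_mul f g) n = (trunc N f * trunc N g)`_n.
Proof.
move=> ltnN /=; rewrite coefM; apply: eq_bigr => i _.
rewrite !coef_poly (leq_ltn_trans _ ltnN) ?(leq_ltn_trans _ ltnN) ?leq_subr //.
by rewrite -ltnS.
Qed.

Fact fps_mulA : associative fps_mul.
Proof.
move=> f g h; apply: fpsP => n.
transitivity ((trunc n.+1 f * trunc n.+1 g * trunc n.+1 h)`_n).
  rewrite -mulrA coefM [LHS]/=; apply: eq_bigr => i _.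
  rewrite coef_poly ltn_ord; congr (_ * _).
  by apply: fps_mul_trunc; rewrite ltnS leq_subr.
rewrite coefM [RHS]/=; apply: eq_bigr => i _.
rewrite [in X in _ * X]coef_poly ltnS leq_subr; congr (_ * _).
by rewrite -fps_mul_trunc.
Qed.

Fact fps_mulC : commutative fps_mul.
Proof.
move=> f g; apply: fpsP => n.
by rewrite !(@fps_mul_trunc n.+1) // mulrC.
Qed.

Fact fps_mul1 : left_id fps1 fps_mul.
Proof.
move=> f; apply: fpsP => n /=.
rewrite big_ord_recl /= mul1r subn0 big1 ?addr0 // => i _.
by rewrite mul0r.
Qed.

Fact fps_mulDl : left_distributive fps_mul fps_add.
Proof.
move=> f g h; apply: fpsP => n /=; rewrite -big_split /=.
by apply: eq_bigr => i _; rewrite mulrDl.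
Qed.

Fact fps1_neq0 : fps1 != 0.
Proof.
apply/eqP => /(congr1 (fun f => fps_coef f 0)) /= /eqP.
by rewrite oner_eq0.
Qed.

HB.instance Definition _ := GRing.Zmodule_isComNzRing.Build (fps R)
  fps_mulA fps_mulC fps_mul1 fps_mulDl fps1_neq0.

Definition fps_unit : {pred fps R} := fun f => `[< exists g, g * f = 1 >].
Definition fps_inv f : fps R := xget f [set g | g * f = 1].

Fact fps_mulVr : {in fps_unit, left_inverse 1 fps_inv *%R}.
Proof. by move=> f /asboolP /(xgetPex f). Qed.
Fact fps_unitPl f g : g * f = 1 -> fps_unit f.
Proof. by move=> gf1; apply/asboolP; exists g. Qed.
Fact fps_inv_out : {in [predC fps_unit], fps_inv =1 id}.
Proof.
move=> f; rewrite inE => /asboolPn nUf; apply: xgetPN => g gf1.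
by apply: nUf; exists g.
Qed.

HB.instance Definition _ := GRing.ComNzRing_hasMulInverse.Build (fps R)
  fps_mulVr fps_unitPl fps_inv_out.

Definition fps_q : fps R := FPS (fun n => (n == 1%N)%:R).

(* Sum of a possibly infinite family of power series: each coefficient is a   *)
(* sum with finite support (and the junk value 0 if the support is infinite). *)
Definition fps_sum (I : choiceType) (A : set I) (F : I -> fps R) : fps R :=
  FPS (fun n => \sum_(i \in A) fps_coef (F i) n).

Definition fps_summable (I : choiceType) (A : set I) (F : I -> fps R) : Prop :=
  forall n, finite_set (A `&` [set i | fps_coef (F i) n != 0])%classic.

Lemma fps_coefM f g n :
  fps_coef (f * g) n = \sum_(k < n.+1) fps_coef f k * fps_coef g (n - k)%N.
Proof. by []. Qed.

Lemma fps_coefB f g n : fps_coef (f - g) n = fps_coef f n - fps_coef g n.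
Proof. by []. Qed.

Lemma fps_coefqX k n : fps_coef (fps_q ^+ k) n = (n == k)%:R.
Proof.
elim: k n => [//|k IHk] n; rewrite exprS fps_coefM.
case: n => [|n]; first by rewrite big_ord1 mul0r.
rewrite big_ord_recl mul0r add0r big_ord_recl /= mul1r subSS subn0 IHk eqSS.
by rewrite big1 ?addr0 // => i _; rewrite mul0r.
Qed.

Lemma fps_coef_qXM k f n :
  fps_coef (fps_q ^+ k * f) n = if (n < k)%N then 0 else fps_coef f (n - k).
Proof.
rewrite fps_coefM; case: ltnP => [ltnk|lekn].
  rewrite big1 // => i _; rewrite fps_coefqX ltn_eqF ?mul0r //.
  by rewrite (leq_ltn_trans _ ltnk) // -ltnS.
have ltk : (k < n.+1)%N by [].
rewrite (bigD1 (Ordinal ltk)) //= fps_coefqX eqxx mul1r big1 ?addr0 // => i.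
by rewrite fps_coefqX -val_eqE /= => /negPf ->; rewrite mul0r.
Qed.

Lemma unit_1BqX k : (0 < k)%N -> (1 - fps_q ^+ k : fps R) \is a GRing.unit.
Proof.
move=> k_gt0; pose g : fps R := FPS (fun n => (k %| n)%N%:R).
apply/asboolP; exists g; rewrite mulrC mulrBl mul1r; apply: fpsP => n.
rewrite fps_coefB fps_coef_qXM; case: ltnP => [ltnk|lekn] /=.
  rewrite subr0; case: posnP => [->|n_gt0]; first by rewrite dvdn0.
  by rewrite gtnNdvd.
rewrite dvdn_subl ?dvdnn // subrr.
by case: n lekn k_gt0 => //; rewrite leqn0 => /eqP->.
Qed.

End FpsRing.

Notation "''q'" := (fps_q int) (at level 0) : ring_scope.

(* Rows, columns and parts are numbered from 1: [part la i] is the i-th part  *)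
(* of [la] for 1 <= i, and is 0 beyond the length of [la].                    *)
Definition is_partition (la : seq nat) : bool :=
  sorted geq la && (0%N \notin la).

Definition part (la : seq nat) (i : nat) : nat := nth 0%N la i.-1.

Definition conj_part (la : seq nat) : seq nat :=
  [seq count (leq j) la | j <- iota 1 (part la 1)].

Definition cell : choiceType := (nat * nat)%type.

Definition young (la : seq nat) : {fset cell} :=
  [fset ((i, j) : cell) | i in iota 1 (size la), j in iota 1 (part la i)]%fset.

(* On the cells of the diagram, the subtraction is not truncated. *)
Definition hook (la : seq nat) (u : cell) : nat :=
  (part la u.1 + part (conj_part la) u.2 + 1 - (u.1 + u.2))%N.

Definition skew (la mu : seq nat) : {fset cell} := (young la `\` young mu)%fset.

Definition RPP (la mu : seq nat) : set {ffun skew la mu -> nat} :=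
  [set pi | forall u v : skew la mu,
     [|| ((val u).1 == (val v).1) && ((val u).2 <= (val v).2)%N
       | ((val u).2 == (val v).2) && ((val u).1 <= (val v).1)%N] ->
     (pi u <= pi v)%N]%classic.
Arguments RPP : clear implicits.

Definition rpp_size (la mu : seq nat) (pi : {ffun skew la mu -> nat}) : nat :=
  (\sum_u pi u)%N.

Definition south (u : cell) : cell := (u.1.+1, u.2).
Definition east (u : cell) : cell := (u.1, u.2.+1).
Definition southeast (u : cell) : cell := (u.1.+1, u.2.+1).

Definition active (la : seq nat) (D : {fset cell}) (u : cell) : bool :=
  [&& u \in D, south u \in (young la `\` D)%fset,
      east u \in (young la `\` D)%fset
    & southeast u \in (young la `\` D)%fset].

Definition excited_move (u : cell) (D : {fset cell}) : {fset cell} :=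
  (southeast u |` (D `\ u))%fset.

Inductive excited (la mu : seq nat) : {fset cell} -> Prop :=
| excited_start : excited la mu (young mu)
| excited_step D u : excited la mu D -> active la D u ->
    excited la mu (excited_move u D).

Definition excited_diagrams (la mu : seq nat) : {fset {fset cell}} :=
  [fset D in fpowerset (young la) | `[< excited la mu D >]]%fset.

Definition move_peaks (u : cell) (P : {fset cell}) : {fset cell} :=
  (u |` (P `\` [fset east u; south u]))%fset.

(* [peaks la mu D P]: some sequence of excited moves from [mu] to D produces  *)
(* the set P. As P depends only on D (lemma [peaks_inj]), the function        *)
(* [excited_peaks] satisfies the recursive definition of the excited peaks    *)
(* (lemmas [excited_peaks_start] and [excited_peaks_move]).                   *)
Inductive peaks (la mu : seq nat) : {fset cell} -> {fset cell} -> Prop :=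
| peaks_start : peaks la mu (young mu) fset0
| peaks_step D P u : peaks la mu D P -> active la D u ->
    peaks la mu (excited_move u D) (move_peaks u P).

Definition excited_peaks (la mu : seq nat) (D : {fset cell}) : {fset cell} :=
  xget fset0%fset [set P | peaks la mu D P]%classic.

Definition peak_weight (la mu : seq nat) (D : {fset cell}) : nat :=
  (\sum_(u <- excited_peaks la mu D) hook la u)%N.

Lemma part_sorted la i j : is_partition la -> (i <= j)%N ->
  (part la j <= part la i)%N.
Proof.
case/andP=> s_la _ leij; rewrite /part.
have [lt_j|le_j] := ltnP j.-1 (size la); last by rewrite nth_default.
have geq_tr : transitive geq by move=> a b c /= ba cb; apply: leq_trans cb ba.
have lei : (i.-1 <= j.-1)%N by rewrite -!subn1 leq_sub2r.
have := sorted_leq_nth geq_tr leqnn 0%N s_la.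
by apply; rewrite ?inE // (leq_ltn_trans lei).
Qed.

Lemma mem_young la (u : cell) :
  (u \in young la) = [&& 0 < u.1, 0 < u.2 & u.2 <= part la u.1]%N.
Proof.
case: u => i j /=; apply/imfset2P/and3P => /= [[i' + [j' + [-> ->]]]|[i0 j0 le]].
  by rewrite !mem_iota !add1n !ltnS => /andP[-> _] /andP[-> ->].
have lti : (i.-1 < size la)%N.
  rewrite ltnNge; apply/negP => /(nth_default 0%N) e.
  by move: le; rewrite /part e leqNgt j0.
exists i; first by rewrite mem_iota i0 add1n ltnS -(prednK i0).
by exists j => //; rewrite mem_iota j0 add1n ltnS.
Qed.

Lemma part_conj la j : (0 < j)%N ->
  is_partition la -> part (conj_part la) j = count (leq j) la.
Proof.
move=> j0 pla; rewrite /conj_part {1}/part.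
have [lt|le] := ltnP j.-1 (part la 1).
  by rewrite (nth_map 0%N) ?size_iota // nth_iota // add1n prednK.
rewrite nth_default ?size_map ?size_iota //; apply/esym/eqP.
rewrite -leqn0 leqNgt -has_count; apply/hasPn => x /(nthP 0%N)[i lti <-].
rewrite -ltnNge -(prednK j0) ltnS; apply: leq_trans le.
exact: (@part_sorted la 1 i.+1 pla isT).
Qed.

Lemma hook_gt0 la u : is_partition la -> u \in young la -> (0 < hook la u)%N.
Proof.
move=> pla; rewrite mem_young => /and3P[i0 j0 le].
rewrite subn_gt0 addn1 ltnS addnC leq_add // part_conj //.
have szi : (u.1 <= size la)%N.
  rewrite leqNgt; apply/negP => lt; have := leq_trans j0 le.
  by rewrite /part nth_default // -ltnS prednK.
rewrite -[la in count _ la](cat_take_drop u.1 la) count_cat.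
have /eqP -> : count (leq u.2) (take u.1 la) == size (take u.1 la).
  rewrite -all_count; apply/allP => x /(nthP 0%N)[i].
  rewrite size_takel // => lti <-; rewrite nth_take //.
  by apply: leq_trans le _; apply: (@part_sorted la i.+1 u.1).
by rewrite size_takel // leq_addr.
Qed.

Lemma rpp_summable la mu :
  fps_summable (RPP la mu) (fun pi => 'q ^+ rpp_size pi).
Proof.
move=> n.
pose F (g : {ffun skew la mu -> 'I_n.+1}) : {ffun skew la mu -> nat} :=
  [ffun u => val (g u)].
apply: (@sub_finite_set _ _ (F @` [set: {ffun skew la mu -> 'I_n.+1}])%classic).
  move=> pi [_ /=]; rewrite fps_coefqX.
  have [en _|_] := eqVneq n (rpp_size pi); last by rewrite eqxx.
  have lepi u : (pi u < n.+1)%N.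
    by rewrite ltnS en /rpp_size (bigD1 u) //= leq_addr.
  exists [ffun u => Ordinal (lepi u)] => //.
  by apply/ffunP => u; rewrite !ffunE.
exact/finite_image/finite_finset.
Qed.

Lemma excited_sub la mu D : (young mu `<=` young la)%fset ->
  excited la mu D -> (D `<=` young la)%fset.
Proof.
move=> sub; elim=> // {}D u _ sD /and4P[_ _ _]; rewrite inE => /andP[_ se].
by rewrite fsubUset fsub1set se (fsubset_trans (fsubD1set _ _)).
Qed.

Lemma mem_excited_diagrams la mu D : (young mu `<=` young la)%fset ->
  reflect (excited la mu D) (D \in excited_diagrams la mu).
Proof.
move=> sub; rewrite !inE /= fpowersetE; apply: (iffP andP) => [[_ /asboolP]//|eD].
by split; [exact: excited_sub eD | exact/asboolP].
Qed.

Fixpoint legal la (D : {fset cell}) (s : seq cell) : bool :=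
  if s is u :: s' then active la D u && legal la (excited_move u D) s' else true.

Definition run_move (DP : {fset cell} * {fset cell}) (u : cell) :=
  (excited_move u DP.1, move_peaks u DP.2).

Lemma legal_rcons la D P s u : legal la D (rcons s u) =
  legal la D s && active la (foldl run_move (D, P) s).1 u.
Proof.
elim: s D P => [|v s IHs] D P /=; first by rewrite andbT.
by rewrite (IHs _ (move_peaks v P)) andbA.
Qed.

Lemma peaks_run la mu D P : peaks la mu D P ->
  exists2 s, legal la (young mu) s & foldl run_move (young mu, fset0%fset) s = (D, P).
Proof.
elim=> [|{}D {}P u _ [s ls es] au]; first by exists [::].
exists (rcons s u); first by rewrite (legal_rcons _ _ fset0%fset) ls es.
by rewrite foldl_rcons es.
Qed.

Lemma southeast_neq u : (southeast u == u) = false.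
Proof. by case: u => i j; rewrite /southeast xpair_eqE /= gtn_eqF. Qed.

Lemma southeast_inj : injective southeast.
Proof. by case=> i j [k l] [-> ->]. Qed.

Lemma activeC la D u v : u != v -> active la D u -> active la D v ->
  active la (excited_move u D) v.
Proof.
move=> neuv /and4P[uD sD eD seD] /and4P[vD].
rewrite /active !in_fsetE => /andP[svD ->] /andP[evD ->] /andP[sevD ->].
have nevu : v == u = false by rewrite eq_sym; apply: negPf.
rewrite vD nevu (negPf svD) (negPf evD) (negPf sevD) (inj_eq southeast_inj) nevu.
rewrite !andbF !orbF !andbT orbT /=.
move: sD eD; rewrite !in_fsetE => /andP[sD _] /andP[eD _].
apply/andP; split; apply/eqP => e.
  have ev : v = east u by case: u v e {neuv nevu uD sD eD seD vD svD evD sevD} => i j [k l] [-> ->].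
  by rewrite -ev vD in eD.
have ev : v = south u by case: u v e {neuv nevu uD sD eD seD vD svD evD sevD} => i j [k l] [-> ->].
by rewrite -ev vD in sD.
Qed.

Lemma run_moveC la D P u v : u != v -> active la D u -> active la D v ->
  run_move (run_move (D, P) u) v = run_move (run_move (D, P) v) u.
Proof.
move=> neuv /and4P[uD sD eD seD] /and4P[vD svD evD sevD].
rewrite !in_fsetE in sD eD seD svD evD sevD.
case/andP: sD => sD _; case/andP: eD => eD _; case/andP: seD => seD _.
case/andP: svD => svD _; case/andP: evD => evD _; case/andP: sevD => sevD _.
have neq x y : x \in D -> y \notin D -> (x == y) = false.
  by move=> xD yD; apply: contraNF yD => /eqP <-.
have nevu : v == u = false by rewrite eq_sym; apply: negPf.
congr (_, _); apply/fsetP => x; rewrite !in_fsetE.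
  have [->|_] := eqVneq x v; first by rewrite nevu !(neq v) // !andbF.
  have [->|_] := eqVneq x u; first by rewrite !(neq u) // !andbF.
  by rewrite orbCA.
have [->|_] := eqVneq x v; first by rewrite nevu !(neq v).
have [->|_] := eqVneq x u; first by rewrite !(neq u).
by rewrite /= andbCA.
Qed.

(* Number of cells of D weakly northwest of w on its diagonal; it decreases   *)
(* by one when w is moved and is unchanged by the other moves.                *)
Definition nw (w u : cell) : bool :=
  (u.1 + w.2 == u.2 + w.1)%N && (u.1 <= w.1)%N.
Definition nw_count (D : {fset cell}) (w : cell) : nat := (\sum_(u <- D) nw w u)%N.

Lemma nw_southeast w u : (nw w u = nw w (southeast u) + (u == w) :> nat)%N.
Proof.
case: u w => i j [k l]; rewrite /nw /= xpair_eqE !addSn eqSS.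
have [e|ne] := eqVneq (i + l)%N (j + k)%N; last first.
  by case: eqP => //= ei; case: eqP => //= ej; rewrite ei ej addnC eqxx in ne.
rewrite /= leq_eqVlt; have [ei|_] := eqVneq i k; last by rewrite addn0.
rewrite ei ltnn /=; rewrite ei addnC in e.
by move/addIn: e => ->; rewrite eqxx.
Qed.

Lemma nw_count_move la D u w : active la D u ->
  (nw_count D w = nw_count (excited_move u D) w + (u == w))%N.
Proof.
case/and4P=> uD _ _; rewrite in_fsetE => /andP[seD _].
rewrite /nw_count (big_fsetD1 u uD) /= big_fsetU1 /=; last first.
  by rewrite !in_fsetE (negPf seD) andbF.
by rewrite nw_southeast addnAC.
Qed.

Lemma nw_count_run la D P s w : legal la D s ->
  (nw_count D w = nw_count (foldl run_move (D, P) s).1 w + count_mem w s)%N.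
Proof.
elim: s D P => [|u s IHs] D P /=; first by rewrite addn0.
case/andP=> au ls; rewrite (nw_count_move w au) (IHs _ (move_peaks u P) ls).
by rewrite -addnA [X in (_ + X)%N]addnC.
Qed.

Lemma legal_front la D P u s : active la D u -> legal la D s -> u \in s ->
  legal la D (u :: rem u s) /\
  foldl run_move (D, P) (u :: rem u s) = foldl run_move (D, P) s.
Proof.
elim: s D P => [//|v s IHs] D P au /= /andP[av ls].
rewrite inE eq_sym; have [<-|nevu /= us] := eqVneq v u; first by rewrite av ls.
have auv : active la (excited_move v D) u by apply: activeC.
have [/= /andP[_ l1] e1] := IHs _ (move_peaks v P) auv ls us.
have avu : active la (excited_move u D) v by apply: activeC; rewrite // eq_sym.
have := run_moveC P nevu av au; rewrite /run_move /= => -[eD eP].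
by rewrite au avu -eD -eP.
Qed.

Lemma run_inj la D P s t : legal la D s -> legal la D t ->
  (foldl run_move (D, P) s).1 = (foldl run_move (D, P) t).1 ->
  foldl run_move (D, P) s = foldl run_move (D, P) t.
Proof.
move=> ls lt est; have /permP/= : perm_eq s t.
  apply/allP => w _ /=; apply/eqP; have := nw_count_run P w ls.
  by rewrite (nw_count_run P w lt) est => /addnI.
move=> {est} pst; have {pst} : perm_eq s t by apply/permP.
elim: s D P t ls lt => [|u s IHs] D P t; first by rewrite perm_sym => _ _ /perm_nilP->.
move=> /= /andP[au ls] lt pst.
have ut : u \in t by rewrite -(perm_mem pst) inE eqxx.
have [/= /andP[_ l1] <-] := legal_front P au lt ut.
apply: IHs => //; rewrite -(perm_cons u); apply: perm_trans pst _.
exact: perm_to_rem.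
Qed.

Lemma peaks_inj la mu D P Q : peaks la mu D P -> peaks la mu D Q -> P = Q.
Proof.
case/peaks_run=> s ls es /peaks_run[t lt et].
have := run_inj (P := fset0%fset) ls lt; rewrite es et => /(_ erefl).
by case.
Qed.

Lemma excited_peaksP la mu D : excited la mu D ->
  peaks la mu D (excited_peaks la mu D).
Proof.
move=> eD; suff [P pP] : exists P, peaks la mu D P by apply: xgetI pP.
elim: eD => [|{}D u _ [P pP] au]; first by exists fset0%fset; apply: peaks_start.
by exists (move_peaks u P); apply: peaks_step.
Qed.

Lemma excited_peaks_start la mu : excited_peaks la mu (young mu) = fset0%fset.
Proof.
exact: peaks_inj (excited_peaksP (excited_start la mu)) (peaks_start la mu).
Qed.

Lemma excited_peaks_move la mu D u : excited la mu D -> active la D u ->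
  excited_peaks la mu (excited_move u D) = move_peaks u (excited_peaks la mu D).
Proof.
move=> eD au; apply: peaks_inj (peaks_step (excited_peaksP eD) au).
exact/excited_peaksP/excited_step.
Qed.

(* Main.v *)
(* Expand both sides over the ideals A (diagrams of partitions) lying between
   mu and lambda.  Subtracting 1 off its zero set, a reverse plane partition of
   lambda/mu becomes one of lambda/A, so the left-hand series G satisfies
   G_mu = sum_A q^|lambda/A| G_A, which determines it.

   For the right-hand side, an excited diagram is encoded by the number t(v) of
   moves made by each cell v of mu; t is weakly increasing along rows and
   columns, and the excited peaks are the cells v + (s, s) with
   max (t(west v)) (t(north v)) <= s < t(v).  With an arbitrary weight w on the
   cells, Z_mu(lambda) = sum_t prod_peaks w prod_D (1 - w).  If c is a corner of
   lambda, the sum over the t-value of the corner p of mu on the diagonal of c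
   telescopes and gives
     Z_mu(lambda) = w(c) Z_mu(lambda - c) + (1 - w(c)) Z_(mu - p)(lambda - c),
   while Z_mu(lambda) = Z_mu(lambda - c) if there is no such p.  When
   w(i, j) is the ratio of the labels of the j-th horizontal and the i-th
   vertical step of the boundary of lambda, removing corners one by one (which
   swaps two adjacent labels) yields K_lambda Z_mu = sum_A K_A Z_A, where K_A is
   the product of the labels at the positions of the vertical steps of A.
   Specialised to hook lengths this is the recursion satisfied by G. *)
Require Import Defs.
From mathcomp Require Import all_boot all_order all_algebra.
From mathcomp Require Import finmap boolp classical_sets functions cardinality.
From mathcomp Require Import fsbigop.
From mathcomp Require Import zify ring.

Set Implicit Arguments.
Unset Strict Implicit.
Unset Printing Implicit Defensive.

Import GRing.Theory.

(** * Cells and ideals *)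

Definition cell_pos (u : cell) := (0 < u.1) && (0 < u.2).
Definition cell_le (u v : cell) := (u.1 <= v.1) && (u.2 <= v.2).
Definition same_diag (u v : cell) := u.1 + v.2 == u.2 + v.1.
Definition shift (u : cell) (k : nat) : cell := (u.1 + k, u.2 + k).

(** Finite order ideals of the positive quadrant are exactly the diagrams of partitions. As cell
    sets they allow corners to be added and removed by set operations and can be enumerated inside a
    power set. *)
Definition ideal (A : {fset cell}) : Prop :=
  (forall u, u \in A -> cell_pos u) /\
  (forall u v, v \in A -> cell_pos u -> cell_le u v -> u \in A).

Definition addable (A : {fset cell}) (v : cell) : Prop :=
  v \notin A /\ ideal (v |` A)%fset.
Definition removable (A : {fset cell}) (v : cell) : Prop :=
  v \in A /\ ideal (A `\ v)%fset.

Lemma cell_eqE (u v : cell) : (u == v) = (u.1 == v.1) && (u.2 == v.2).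
Proof. by case: u v => [? ?] [? ?]; rewrite xpair_eqE. Qed.

(* [lia] does not see through the [choiceType] structure on the coordinates. *)
Ltac cell_lia := intros; unfold cell_pos, cell_le, same_diag, shift in *;
  repeat match goal with H : is_true _ |- _ => revert H end;
  repeat match goal with H : _ = _ |- _ => revert H end;
  rewrite ?cell_eqE /=; intros;
  change (Choice.sort Datatypes_nat__canonical__choice_Choice) with nat in *; lia.

Lemma cell_eqP (u v : cell) : u.1 = v.1 -> u.2 = v.2 -> u = v.
Proof. by case: u v => [? ?] [? ?] /= -> ->. Qed.

Lemma shift_diag u v : same_diag u v -> cell_le u v -> v = shift u (v.1 - u.1).
Proof.
by move=> duv luv; apply: cell_eqP; cell_lia.
Qed.

Lemma diag_total u v : same_diag u v -> cell_le u v || cell_le v u.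
Proof. move=> duv; cell_lia. Qed.

Lemma shift_eq u v s s' : shift u s = shift v s' ->
  u.1 + s = v.1 + s' /\ u.2 + s = v.2 + s'.
Proof. by move=> [-> ->]. Qed.

Lemma ideal0 : ideal fset0.
Proof. by split=> [u|u v]; rewrite inE. Qed.

Lemma removable_max A u v : removable A v -> u \in A -> cell_le v u -> cell_pos v -> u = v.
Proof.
move=> [vA [_ iA]] uA vu pv; apply/eqP/negP=> /negP nuv.
by have := iA v u; rewrite !inE eqxx uA nuv /= => /(_ isT pv vu).
Qed.

Lemma addable_below A u v : addable A v -> cell_pos u -> cell_le u v -> u != v -> u \in A.
Proof.
move=> [_ [_ iA]] pu uv nuv; have := iA u v; rewrite !inE eqxx => /(_ isT pu uv).
by rewrite (negPf nuv).
Qed.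

Lemma addable_pos A v : addable A v -> cell_pos v.
Proof. by move=> [_ [+ _]]; apply; rewrite !inE eqxx. Qed.

Lemma addableP A v : ideal A -> v \notin A -> cell_pos v ->
  (forall u, cell_pos u -> cell_le u v -> u != v -> u \in A) -> addable A v.
Proof.
move=> [pA iA] vA pv H; split=> //; split=> [u|x y]; rewrite !inE.
  by case/orP=> [/eqP->|/pA].
have [//|nxv] := eqVneq x v; have [->|nyv] := eqVneq y v => /= yA px xy.
  exact: H.
exact: iA yA px xy.
Qed.

Lemma removableP A v : ideal A -> v \in A ->
  (forall u, u \in A -> cell_le v u -> u = v) -> removable A v.
Proof.
move=> [pA iA] vA H; split=> //; split=> [u|x y]; rewrite !inE.
  by case/andP=> _ /pA.
case/andP=> nyv yA px xy; rewrite (iA _ _ yA px xy) andbT.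
by apply: contra nyv => /eqP xv; apply/eqP; apply: H yA _; rewrite -xv.
Qed.

Lemma addable_removable A v : ideal A -> addable A v -> removable (v |` A)%fset v.
Proof.
move=> iA [vA ivA]; split; first by rewrite !inE eqxx.
by rewrite fsetU1K.
Qed.

Lemma removable_addable A v : ideal A -> removable A v -> addable (A `\ v)%fset v.
Proof. by move=> iA [vA ivA]; split; rewrite ?fsetD1K // !inE eqxx. Qed.

Lemma addable_uniq A u v : addable A u -> addable A v -> same_diag u v -> u = v.
Proof.
move=> au av /diag_total duv; apply/eqP/negP => /negP nuv.
case/orP: duv => [uv|vu].
  by case: (au) => /negP[]; apply: addable_below av (addable_pos au) uv nuv.
case: (av) => /negP[]; apply: addable_below au (addable_pos av) vu _.
by rewrite eq_sym.
Qed.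

Lemma removable_uniq A u v : ideal A -> removable A u -> removable A v ->
  same_diag u v -> u = v.
Proof.
move=> [pA _] ru rv /diag_total /orP[uv|vu].
  by rewrite (removable_max ru _ uv) ?(proj1 rv) ?pA // (proj1 ru).
by rewrite (removable_max rv _ vu) ?(proj1 ru) ?pA // (proj1 rv).
Qed.

(** If [u] precedes [v], then [u] already lies in [A]. If [v] precedes [u], the cell south of [v]
    lies in [A] because it is below [u], against the maximality of [v]. *)
Lemma addable_not_removable A u v : ideal A -> addable A u -> removable A v ->
  ~ same_diag u v.
Proof.
move=> [pA iA] au rv duv; have [vA _] := rv; have [uA _] := au.
have nuv : u != v by apply: contra uA => /eqP->.
have pu := addable_pos au; have pv := pA _ vA.
case/orP: (diag_total duv) => [uv|vu]; first by rewrite (iA _ _ vA pu uv) in uA.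
have svA : (v.1.+1, v.2) \in A.
  by apply: addable_below au _ _ _; cell_lia.
have /eqP := removable_max rv svA ltac:(cell_lia) pv; cell_lia.
Qed.

(** The coordinate sum is bounded on [A] and strictly increases along the order, so climbing from
    any cell ends at a maximal one. *)
Lemma ex_removable A : ideal A -> A != fset0 -> exists v, removable A v.
Proof.
move=> iA /fset0Pn[v0 v0A].
have [B HB] : exists B, forall u, u \in A -> u.1 + u.2 <= B.
  exists (\sum_(u <- A) (u.1 + u.2)) => u uA.
  by rewrite (big_fsetD1 u uA) /= leq_addr.
have [k] := ubnP (B - (v0.1 + v0.2)); elim: k v0 v0A => // k IH v vA hk.
case: (pselect (exists u, [/\ u \in A, cell_le v u & u != v])) => [[u [uA vu nuv]]|no].
  by apply: (IH u uA); have := HB _ uA; cell_lia.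
exists v; apply: removableP => // u uA vu; apply/eqP/negP => /negP nuv.
by case: no; exists u.
Qed.

Local Open Scope ring_scope.

(** * Weighted sums over excited fillings *)

(** The term of index k is the product of [f] over [m, k) minus the product over [m, k + 1). *)
Lemma sum_telescope (R : comNzRingType) (f : nat -> R) m n : (m <= n)%N ->
  \sum_(m <= k < n) (1 - f k) * (\prod_(m <= s < k) f s) = 1 - \prod_(m <= s < n) f s.
Proof.
move=> /subnKC <-; elim: (n - m)%N => [|k IH].
  by rewrite addn0 !big_geq // subrr.
rewrite addnS big_nat_recr ?leq_addr //= IH big_nat_recr ?leq_addr //=; ring.
Qed.

Lemma big_nat_widen_ord (R : nmodType) (F : nat -> R) m n N : (n <= N)%N ->
  \sum_(m <= k < n) F k = \sum_(k < N | (m <= k < n)%N) F k.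
Proof.
move=> nN; rewrite big_geq_mkord /=.
by rewrite (big_ord_widen_cond N (fun i => (m <= i)%N) F nN); apply: eq_bigr.
Qed.

Section Fillings.
Local Open Scope nat_scope.
Variables (U : {fset cell}) (N : nat).
(** Values are bounded by [N] so that fillings form a finite type. Later [N] bounds the row indices
    of [U], hence also the number of moves any cell can make inside [U]. *)
Local Notation filling := {ffun U -> 'I_N.+1}.

(* [ev t] vanishes off U, in particular on the cells of row or column 0 that
   [low] inspects. *)
Definition ev (t : filling) (u : cell) : nat :=
  oapp (fun x : U => val (t x)) 0 (insub u).

(** [inord] replaces a value above [N] by 0; this is why [ev_fill] asks for a bound. *)
Definition fill (g : cell -> nat) : filling := [ffun x : U => inord (g (val x))].

Definition upd (t : filling) (p : cell) (k : nat) : filling :=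
  fill (fun u => if u == p then k else ev t u).

Lemma ev_out t u : u \notin U -> ev t u = 0.
Proof. by move=> uU; rewrite /ev insubN. Qed.

Lemma ev_le t u : ev t u <= N.
Proof. by rewrite /ev; case: insub => //= x; rewrite -ltnS. Qed.

Lemma ev_fill g u : u \in U -> g u <= N -> ev (fill g) u = g u.
Proof. by move=> uU gN; rewrite /ev insubT /= ffunE inordK. Qed.

Lemma ev_inj t t' : (forall u, u \in U -> ev t u = ev t' u) -> t = t'.
Proof.
move=> H; apply/ffunP => x; apply: val_inj; have := H _ (valP x).
by rewrite /ev valK.
Qed.

Lemma ev_upd t p k u : p \in U -> k <= N ->
  ev (upd t p k) u = if u == p then k else ev t u.
Proof.
move=> pU kN; have [uU|nU] := boolP (u \in U).
  by rewrite ev_fill //; case: ifP => // _; rewrite ev_le.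
rewrite !ev_out //; case: eqP => // e; by rewrite e pU in nU.
Qed.

(* [ev t v] counts the excited moves made by the cell v of M. *)
Definition excited_filling (L M : {fset cell}) (t : filling) : Prop :=
  [/\ forall u, u \notin M -> ev t u = 0,
      forall u v, u \in M -> v \in M -> cell_le u v -> ev t u <= ev t v
    & forall u, u \in M -> shift u (ev t u) \in L].

(** The peak that [v] leaves at level s is erased when its west or north neighbour makes its own
    move from level s. The surviving levels are therefore those from [low t v] up to [ev t v],
    excluded. *)
Definition low (t : filling) (v : cell) : nat :=
  maxn (ev t (v.1, v.2.-1)) (ev t (v.1.-1, v.2)).

Lemma excited_filling_low L M t v : ideal M -> excited_filling L M t -> v \in M ->
  low t v <= ev t v.
Proof.
move=> [pM iM] [t0 tm _] vM; have pv := pM _ vM; rewrite geq_max.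
apply/andP; split.
  have [uM|/t0->//] := boolP ((v.1, v.2.-1) \in M); apply: tm => //; cell_lia.
have [uM|/t0->//] := boolP ((v.1.-1, v.2) \in M); apply: tm => //; cell_lia.
Qed.

Lemma low_le L M t u v : ideal M -> excited_filling L M t -> v \in M -> u \in M ->
  cell_le u v -> u != v -> ev t u <= low t v.
Proof.
move=> [pM iM] [t0 tm _] vM uM uv nuv; have pu := pM _ uM; have pv := pM _ vM.
rewrite leq_max; have [lt1|ge1] := ltnP u.1 v.1.
  by apply/orP; right; apply: tm => //; [apply: iM vM _ _|]; cell_lia.
by apply/orP; left; apply: tm => //; [apply: iM vM _ _|]; cell_lia.
Qed.

Variables (R : comNzRingType) (w : cell -> R).

(** The share of [v]: a factor 1 - w at its final position and a factor w at each of its peaks. *)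
Definition cell_weight (t : filling) (v : cell) : R :=
  ((1 - w (shift v (ev t v))) * \prod_(low t v <= s < ev t v) w (shift v s))%R.

Definition excited_sum (L M : {fset cell}) : R :=
  (\sum_(t : filling | `[< excited_filling L M t >]) \prod_(v <- M) cell_weight t v)%R.
Local Notation Z := excited_sum.

Lemma excited_sum_nsub L M : ideal L -> ideal M -> ~ {subset M <= L} -> Z L M = 0%R.
Proof.
move=> [_ iL] [pM _] nML; rewrite /excited_sum big1 // => t /asboolP[_ _ tL].
case: nML => u uM; apply: iL (tL _ uM) (pM _ uM) _; cell_lia.
Qed.

(** Suppose [u] ends at [c]. A cell of [M] southeast of [u] makes at least as many moves, so it ends
    southeast of [c], that is at [c], and equals [u]. Hence [u] would be a corner of [M] on the
    diagonal of [c]. *)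
Lemma excited_filling_nocorner L M c t : ideal L -> ideal M -> removable L c ->
  (forall v, removable M v -> ~ same_diag v c) ->
  excited_filling (L `\ c)%fset M t <-> excited_filling L M t.
Proof.
move=> iL iM rc nM.
split=> -[t0 tm tL]; split=> // u uM; have := tL _ uM; rewrite !inE.
  by case/andP.
move=> ->; rewrite andbT; apply/eqP => e; apply: (nM u); last first.
  rewrite -e; cell_lia.
apply: removableP => // v vM uv; have tuv := tm _ _ uM vM uv.
have pc : cell_pos c by apply: (proj1 iL); case: rc.
have [e1 e2] : c.1 = u.1 + ev t u /\ c.2 = u.2 + ev t u by rewrite -e.
have cv : cell_le c (shift v (ev t v)) by cell_lia.
have := removable_max rc (tL _ vM) cv pc => e'.
have [e3 e4] : c.1 = v.1 + ev t v /\ c.2 = v.2 + ev t v by rewrite -e'.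
by apply: cell_eqP; cell_lia.
Qed.

Lemma excited_sum_nocorner L M c : ideal L -> ideal M -> removable L c ->
  (forall v, removable M v -> ~ same_diag v c) -> Z (L `\ c)%fset M = Z L M.
Proof.
move=> iL iM rc nM; apply: eq_bigl => t; apply/asbool_equiv_eq.
exact: excited_filling_nocorner.
Qed.

Hypothesis boundU : forall u, u \in U -> u.1 <= N.

(** * Summation over the value at a corner of M *)

Section Last.
Variables (L M : {fset cell}) (p : cell) (T : nat).
Hypotheses (iM : ideal M) (LU : {subset L <= U}).
Hypotheses (MU : {subset M <= U}) (rp : removable M p).
Hypothesis Tp : forall k, (shift p k \in L) = (k < T).

Let pM : p \in M := proj1 rp.
Let pU : p \in U := MU pM.
Let pp : cell_pos p := proj1 iM p pM.

Lemma last_bound : T <= N.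
Proof.
case: T Tp => // k Tk; have := boundU (LU (etrans (Tk k) (ltnSn k))).
have := pp; cell_lia.
Qed.

(** As [p] is maximal in [M], it is neither the west nor the north neighbour of a cell of [M]. *)
Lemma low_upd t k v : v \in M -> k <= N -> low (upd t p k) v = low t v.
Proof.
move=> vM kN; have pv := proj1 iM v vM; have pp' := pp.
rewrite /low !ev_upd // !ifN //; apply/negP => /eqP e.
  have [e1 e2] : v.1.-1 = p.1 /\ v.2 = p.2 by rewrite -e.
  by have := removable_max rp vM _ pp => /(_ ltac:(cell_lia)) ?; subst v; cell_lia.
have [e1 e2] : v.1 = p.1 /\ v.2.-1 = p.2 by rewrite -e.
by have := removable_max rp vM _ pp => /(_ ltac:(cell_lia)) ?; subst v; cell_lia.
Qed.

Lemma cell_weight_upd t k v : v \in M -> v != p -> k <= N ->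
  cell_weight (upd t p k) v = cell_weight t v.
Proof.
by move=> vM nvp kN; rewrite /cell_weight low_upd // ev_upd // (negPf nvp).
Qed.

Lemma excited_filling_upd0 t : excited_filling L M t ->
  excited_filling L (M `\ p)%fset (upd t p 0).
Proof.
move=> [t0 tm tL]; split=> [u|u v|u]; rewrite ?inE !ev_upd //.
- by case: eqP => //= _ /t0.
- by case: eqP => //= _ uM; case: eqP => //= _; apply: tm.
- by case: eqP => //= _; apply: tL.
Qed.

(** By maximality of [p], monotonicity bounds the value at [p] only from below, through its two
    neighbours; the upper bound says that [p] stays in [L]. *)
Lemma excited_filling_updE t k : k <= N -> excited_filling L (M `\ p)%fset t ->
  excited_filling L M (upd t p k) <-> low t p <= k < T.
Proof.
move=> kN vt; have [t0 tm tL] := vt; split=> [vk|/andP[lk kT]].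
  apply/andP; split.
    by have := excited_filling_low iM vk pM; rewrite low_upd // ev_upd // eqxx.
  by have [_ _ /(_ p pM)] := vk; rewrite ev_upd // eqxx Tp.
have inMp u : u \in M -> u != p -> u \in (M `\ p)%fset by rewrite !inE => -> ->.
split=> [u|u v uM vM|u uM]; rewrite ?ev_upd //.
- have [->|nup] := eqVneq u p; first by rewrite pM.
  by move=> uM; apply: t0; rewrite !inE (negPf uM) andbF.
- have [eu|nup] := eqVneq u p.
    move=> pv; rewrite eu in pv.
    by have := removable_max rp vM pv pp => ->; rewrite eqxx.
  have [ev|nvp] := eqVneq v p; last by apply: tm; exact: inMp.
  rewrite ev => up; apply: leq_trans lk.
  have pu := proj1 iM u uM; have pp' := pp; have [pM' iM'] := iM.
  rewrite leq_max; have [lt1|ge1] := ltnP u.1 p.1.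
    apply/orP; right; apply: tm; [exact: inMp| |cell_lia].
    by apply: inMp; [apply: iM' pM _ _|]; cell_lia.
  apply/orP; left; apply: tm; [exact: inMp| |cell_lia].
  by apply: inMp; [apply: iM' pM _ _|]; cell_lia.
- have [->|nup] := eqVneq u p; first by rewrite Tp.
  by apply: tL; exact: inMp.
Qed.

(** Fillings are grouped by their restriction to the cells other than [p], represented by the
    filling with value 0 at [p]. Inside a group only the factor of [p] varies, and its sum
    telescopes. *)
Lemma excited_sum_last : (forall t, excited_filling L (M `\ p)%fset t -> low t p <= T) ->
  Z L M = (\sum_(t : filling | `[< excited_filling L (M `\ p)%fset t >])
    (\prod_(v <- (M `\ p)%fset) cell_weight t v) *
    (1 - \prod_(low t p <= s < T) w (shift p s)))%R.
Proof.
move=> lowT; have TN := last_bound.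
rewrite /excited_sum (partition_big (fun t => upd t p 0)
  (fun t => `[< excited_filling L (M `\ p)%fset t >])) /=; last first.
  by move=> t /asboolP vt; apply/asboolP/excited_filling_upd0.
apply: eq_bigr => t /asboolP vt.
have tp0 : ev t p = 0 by have [t0 _ _] := vt; apply: t0; rewrite !inE eqxx.
(* The members of the group of [t] are parametrised by their value at [p]. *)
rewrite (reindex_onto (fun k : 'I_N.+1 => upd t p k)
  (fun t' => inord (ev t' p))) /=; last first.
  move=> t' /andP[_ /eqP <-]; apply: ev_inj => u uU.
  rewrite inordK ?ltnS ?ev_le // ev_upd ?ev_le //.
  by case: eqP => [->//|/eqP nup]; rewrite ev_upd // (negPf nup).
rewrite -sum_telescope ?lowT // big_distrr /=.
rewrite (big_nat_widen_ord _ _ (leqW TN)) /=.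
apply: eq_big => [k|k].
  have kN : k <= N by rewrite -ltnS.
  rewrite ev_upd // eqxx inord_val eqxx andbT.
  have -> : upd (upd t p k) p 0 == t.
    apply/eqP/ev_inj => u uU; rewrite !ev_upd //.
    by case: eqP => // ->.
  by rewrite andbT; apply/asboolP/idP => /(excited_filling_updE kN vt).
case/andP => /andP[/asboolP _ _ _].
have kN : k <= N by rewrite -ltnS.
rewrite (big_fsetD1 p pM) /= mulrC; congr (_ * _)%R.
  rewrite big_seq [RHS]big_seq; apply: eq_bigr => v.
  by rewrite !inE => /andP[nvp vM]; apply: cell_weight_upd.
by rewrite /cell_weight low_upd // ev_upd // eqxx.
Qed.

End Last.

(** Write c = p + (k0, k0). Summing over the value at [p] leaves 1 - P w(c) for [L] and 1 - P for
    [L] without [c], where P is the product of w over the levels below k0. The identity is then 1 -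
    P w(c) = w(c) (1 - P) + (1 - w(c)), filling by filling. *)
Lemma excited_sum_corner L M c : ideal L -> ideal M -> {subset L <= U} -> {subset M <= U} ->
  removable L c -> forall p, removable M p -> same_diag p c ->
  Z L M = (w c * Z (L `\ c)%fset M + (1 - w c) * Z (L `\ c)%fset (M `\ p)%fset)%R.
Proof.
move=> iL iM LU MU rc p rp dpc.
have [cL iLc] := rc; have [pM iMp] := rp.
have pc := proj1 iL c cL; have pp := proj1 iM p pM.
(* If [p] is not weakly northwest of [c], it is strictly southeast of it, hence outside [L], and all
   three sums vanish; the last one because [c] lies in [M] without [p] but not in [L] without
   [c]. *)
have [pc_le|npc] := boolP (cell_le p c); last first.
  have cp : cell_le c p by have := diag_total dpc; rewrite (negPf npc).
  have nep : c != p by apply: contraNneq npc => <-; cell_lia.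
  have pL : p \notin L.
    by apply/negP => /(removable_max rc) /(_ cp pc) e; rewrite e eqxx in nep.
  rewrite !excited_sum_nsub ?mulr0 ?addr0 // => [/(_ c)|/(_ p pM)|/(_ p pM)].
  - by rewrite !inE eqxx nep (proj2 iM _ _ pM pc cp) => /(_ isT).
  - by rewrite !inE (negPf pL) andbF.
  - by rewrite (negPf pL).
have [k0 ec] : exists k, c = shift p k by exists (c.1 - p.1); apply: shift_diag.
have TL k : (shift p k \in L) = (k < k0.+1).
  apply/idP/idP => [kL|kk0].
    rewrite ltnNge; apply/negP => lk.
    have : shift p k = c by apply: removable_max rc kL _ pc; rewrite ec; cell_lia.
    by rewrite ec => /shift_eq [? ?]; cell_lia.
  by apply: (proj2 iL) cL _ _; rewrite ?ec; cell_lia.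
have TL' k : (shift p k \in (L `\ c)%fset) = (k < k0).
  rewrite !inE TL ec cell_eqE /= !eqn_add2l andbb ltnS ltn_neqAle.
  by [].
have nM v : removable (M `\ p)%fset v -> ~ same_diag v c.
  move=> rv dvc; apply: (addable_not_removable iMp (removable_addable iM rp) rv).
  by move: dpc dvc; cell_lia.
(* A neighbour of [p] moving more than [k0] times would end weakly southeast of [c], hence at [c],
   which is not on its diagonal. *)
have lowk t : excited_filling L (M `\ p)%fset t -> low t p <= k0.
  move=> [t0 _ tL].
  have H u : p.1 <= u.1.+1 -> p.2 <= u.2.+1 -> p.1 + p.2 <= (u.1 + u.2).+1 ->
      ev t u <= k0.
    move=> l1 l2 l3; have [uM|/t0->//] := boolP (u \in (M `\ p)%fset).
    rewrite leqNgt; apply/negP => lk.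
    have : shift u (ev t u) = c.
      by apply: (removable_max rc (tL _ uM) _ pc); rewrite ec; cell_lia.
    by rewrite ec => /shift_eq [? ?]; cell_lia.
  by rewrite geq_max !H //=; cell_lia.
have iffV t := excited_filling_nocorner t iL iMp rc nM.
have LU' : {subset (L `\ c)%fset <= U} by move=> u; rewrite inE => /andP[_ /LU].
have EV (F : filling -> R) :
    (\sum_(t | `[< excited_filling (L `\ c)%fset (M `\ p)%fset t >]) F t =
     \sum_(t | `[< excited_filling L (M `\ p)%fset t >]) F t)%R.
  by apply: eq_bigl => t; apply: asbool_equiv_eq.
rewrite (excited_sum_last iM LU MU rp TL); last by move=> t /lowk /leqW.
rewrite (excited_sum_last iM LU' MU rp TL'); last by move=> t /iffV /lowk.
rewrite /excited_sum !EV.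
rewrite !big_distrr -big_split /=; apply: eq_bigr => t /asboolP /lowk lt.
rewrite big_nat_recr //= -ec; ring.
Qed.

End Fillings.

(** * Row lengths and boundary labels *)

Definition row_len (A : {fset cell}) (i : nat) : nat :=
  (\max_(u <- A | u.1 == i) u.2)%N.

Lemma mem_row_len A i j : ideal A -> (0 < i)%N -> (0 < j)%N ->
  ((i, j) \in A) = (j <= row_len A i)%N.
Proof.
move=> [pA iA] i0 j0; apply/idP/idP => [ijA|jl].
  exact: (@leq_bigmax_seq _ _ _ (fun u : cell => u.2) (i, j)).
apply/negP => nij; suff : (row_len A i <= j.-1)%N by cell_lia.
apply/bigmax_leqP_seq => u uA /eqP ui; rewrite leqNgt; apply/negP => lt.
by apply: nij; apply: iA uA _ _; cell_lia.
Qed.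

Lemma row_len_uniq A i m : ideal A -> (0 < i)%N ->
  (forall j, (0 < j)%N -> ((i, j) \in A) = (j <= m)%N) -> row_len A i = m.
Proof.
move=> iA i0 H; apply/eqP; rewrite eqn_leq; apply/andP; split.
  case e: (row_len A i) => [//|k]; rewrite -H // mem_row_len // e //.
by case: m H => [//|k] H; rewrite -mem_row_len // H.
Qed.

Lemma row_len_anti A i i' : ideal A -> (0 < i)%N -> (i <= i')%N ->
  (row_len A i' <= row_len A i)%N.
Proof.
move=> iA i0 ii'; case e: (row_len A i') => [//|k].
rewrite -mem_row_len //; apply: (proj2 iA) (i', k.+1) _ _ _; try cell_lia.
by rewrite mem_row_len ?e //; cell_lia.
Qed.

Lemma row_len_addable A v : ideal A -> addable A v ->
  [/\ row_len A v.1 = v.2.-1, row_len (v |` A)%fset v.1 = v.2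
    & forall i, (0 < i)%N -> i != v.1 -> row_len (v |` A)%fset i = row_len A i].
Proof.
move=> iA av; have pv := addable_pos av; have [vA ivA] := av.
have v10 : (0 < v.1)%N by cell_lia.
have below j : (0 < j)%N -> (j < v.2)%N -> (v.1, j) \in A.
  by move=> j0 jv; apply: addable_below av _ _ _; cell_lia.
have above j : (v.2 <= j)%N -> (v.1, j) \notin A.
  by move=> jv; apply: contra vA => /(proj2 iA); apply; cell_lia.
split=> [||i i0 niv].
- apply: row_len_uniq => // j j0; have [jv|vj] := ltnP j v.2.
    by rewrite below //; apply/esym; cell_lia.
  by rewrite (negPf (above _ vj)); apply/esym/negP; cell_lia.
- apply: row_len_uniq => // j j0; rewrite !inE.
  have [jv|vj] := ltnP j v.2; first by rewrite below // orbT; apply/esym; cell_lia.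
  rewrite (negPf (above _ vj)) orbF cell_eqE eqxx /=; cell_lia.
- apply: row_len_uniq => // j j0; rewrite !inE cell_eqE (negPf niv) /=.
  exact: mem_row_len.
Qed.

(** The transposition of the boundary positions p - 1 and p: removing a corner of content p
    exchanges a horizontal and a vertical step there. *)
Definition swap_content (p x : int) : int :=
  if x == p then p - 1 else if x == p - 1 then p else x.

Definition content (v : cell) : int := v.2%:Z - v.1%:Z.

Section RowWeight.
Variables (R : comNzRingType) (N : nat).
Implicit Types (tau : int -> R) (A : {fset cell}) (v : cell).

(** Empty rows are included, so the number of vertical steps is [N] for every [A]. *)
Definition row_weight tau A : R :=
  \prod_(i < N) tau ((row_len A i.+1)%:Z - (i.+1)%:Z).

(** Adding [v] moves the vertical step of its row from [content v - 1] to [content v]. The common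
    factor X collects the other rows. *)
Lemma row_weight_addable tau A v : ideal A -> addable A v -> (v.1 <= N)%N ->
  exists X, [/\ row_weight tau A = tau (content v - 1) * X,
    row_weight tau (v |` A)%fset = tau (content v) * X,
    row_weight (tau \o swap_content (content v)) A = tau (content v) * X &
    row_weight (tau \o swap_content (content v)) (v |` A)%fset =
      tau (content v - 1) * X].
Proof.
move=> iA av vN; have pv := addable_pos av; have [r1 r2 r3] := row_len_addable iA av.
have lt : (v.1.-1 < N)%N by cell_lia.
have e1 : v.1.-1.+1 = v.1 by cell_lia.
pose i0 := Ordinal lt.
exists (\prod_(i < N | i != i0) tau ((row_len A i.+1)%:Z - (i.+1)%:Z)).
have nei (i : 'I_N) : i != i0 -> i.+1 != v.1.
  by apply: contra => /eqP h; apply/eqP/val_inj; rewrite /= -h.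
have sw0 : swap_content (content v) (content v - 1) = content v.
  by rewrite /swap_content eqxx; case: eqP => //; lia.
have sw1 : swap_content (content v) (content v) = content v - 1.
  by rewrite /swap_content eqxx.
have c0 : (row_len A v.1)%:Z - v.1%:Z = content v - 1.
  by rewrite r1 /content; cell_lia.
have c1 : (row_len (v |` A)%fset v.1)%:Z - v.1%:Z = content v.
  by rewrite r2.
(* Rows above that of [v] reach column [v.2], so their steps lie beyond [content v]; rows below are
   shorter than [v.2], so theirs lie before [content v - 1]. *)
have swi (i : 'I_N) : i != i0 ->
   swap_content (content v) ((row_len A i.+1)%:Z - (i.+1)%:Z) =
   (row_len A i.+1)%:Z - (i.+1)%:Z.
  move=> /nei ni; rewrite /swap_content /content.
  have [lti|gti] := ltnP i.+1 v.1.
    have : (i.+1, v.2) \in A by apply: addable_below av _ _ _; cell_lia.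
    rewrite mem_row_len //; last by cell_lia.
    by do !case: eqP => //; cell_lia.
  have : (row_len A i.+1 <= v.2.-1)%N by rewrite -r1; apply: row_len_anti => //; cell_lia.
  by do !case: eqP => //; cell_lia.
split; rewrite /row_weight (bigD1 i0) //= e1 ?c0 ?c1 ?sw0 ?sw1; congr (_ * _);
  apply: eq_bigr => i ni; rewrite ?r3 ?nei // ?swi //.
Qed.

(** A vertical step at [content c] but none at [content c - 1] gives a removable cell on the
    diagonal of [c]; the opposite situation gives an addable one. Otherwise both positions carry a
    vertical step or neither does, and the product is symmetric in the two labels. *)
Lemma row_weight_swap tau A c : ideal A -> (forall u, u \in A -> (u.1 <= N)%N) ->
  cell_pos c -> (c.1 <= N)%N ->
  (forall v, same_diag v c -> ~ addable A v) ->
  (forall v, same_diag v c -> ~ removable A v) ->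
  row_weight (tau \o swap_content (content c)) A = row_weight tau A.
Proof.
move=> iA AN pc cN nadd nrem.
pose f i : int := (row_len A i.+1)%:Z - (i.+1)%:Z.
have fE i : f i = (row_len A i.+1)%:Z - (i.+1)%:Z by [].
have fanti i i' : (i < i')%N -> f i' < f i.
  by move=> ii'; have := @row_len_anti A i.+1 i'.+1 iA isT (ltnW ii'); rewrite !fE; lia.
have [[i fi]|none] := pselect (exists i : 'I_N, f i = content c).
  have [lti1 fi1] : (i.+1 < N)%N /\ f i.+1 = content c - 1.
    have := fanti i i.+1 (ltnSn i).
    (* If the row is empty, so is the next one, which is still among the first [N] rows: its index
       is c.1 - c.2 + 1, at most c.1. *)
    case: (posnP (row_len A i.+1)) => [e0|r0].
      have := fi; rewrite !fE /content e0.
      by have := @row_len_anti A i.+1 i.+2 iA isT (leqnSn _); cell_lia.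
    have inA : (i.+1, row_len A i.+1) \in A by rewrite mem_row_len.
    have dc : same_diag (i.+1, row_len A i.+1) c.
      by have := fi; rewrite fE /content; cell_lia.
    have [sA|nsA] := boolP ((i.+2, row_len A i.+1) \in A).
      split; first by have /= := AN _ sA.
      have := sA; rewrite mem_row_len // => h.
      by move: fi; rewrite !fE; have := @row_len_anti A i.+1 i.+2 iA isT (leqnSn _); cell_lia.
    case: (nrem _ dc); apply: removableP => // u uA ile.
    have pu := proj1 iA u uA; have := mem_row_len iA (i := u.1) (j := u.2).
    rewrite -surjective_pairing uA => h.
    have {}h : (u.2 <= row_len A u.1)%N by rewrite -h //; cell_lia.
    have l1 := @row_len_anti A i.+1 u.1 iA isT ltac:(cell_lia).
    have [eu|nu] := eqVneq u.1 i.+1; first by apply: cell_eqP; cell_lia.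
    case/negP: nsA; apply: (proj2 iA) uA _ _; cell_lia.
  pose j := Ordinal lti1.
  have nji : j != i by rewrite -val_eqE /=; cell_lia.
  rewrite /row_weight (bigD1 i) // (bigD1 j) //= [RHS](bigD1 i) // (bigD1 j) //=.
  rewrite -!fE fi fi1 /swap_content !eqxx mulrCA; case: eqP => [|_]; first lia.
  congr (_ * (_ * _)); apply: eq_bigr => k /andP[nki nkj] /=.
  have [ki|ik] := ltnP k i; first by have := fanti _ _ ki; rewrite -fE; do !case: eqP => //; lia.
  have jk : (j < k)%N.
    by move: nki nkj ik; rewrite -!val_eqE /=; lia.
  by have := fanti _ _ jk; rewrite /= fi1 -fE; do !case: eqP => //; lia.
apply: eq_bigr => i _ /=; rewrite -fE /swap_content.
case: eqP => [fi|_]; first by case: none; exists i.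
case: eqP => [fi|//]; exfalso.
have dc : same_diag (i.+1, (row_len A i.+1).+1) c.
  by have := fi; rewrite fE /content; cell_lia.
apply: (nadd _ dc); apply: addableP => //.
  by rewrite mem_row_len // ltnn.
move=> u pu ule nu.
have [eu|neu] := eqVneq u.1 i.+1.
  by rewrite [u]surjective_pairing eu mem_row_len //; cell_lia.
have i0 : (0 < i)%N by cell_lia.
have lti1 : (i.-1 < N)%N by have := ltn_ord i; lia.
(* If rows [i] and [i.+1] had equal length, the step of row [i] would sit at [content c]. So row [i]
   is longer and contains the cell above the candidate. *)
have : f i.-1 <> content c by move=> h; apply: none; exists (Ordinal lti1).
have := @row_len_anti A i i.+1 iA i0 (leqnSn _).
move: fi; rewrite !fE prednK // => fi l1 l2.
have inA : ((i : nat), (row_len A i.+1).+1) \in A by rewrite mem_row_len //; lia.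
by apply: (proj2 iA) inA _ _; cell_lia.
Qed.

End RowWeight.

(** * Expansion over ideals *)

Lemma big_fset_uniq1 (R : nmodType) (I : choiceType) (A : {fset I}) (P : pred I)
  (F : I -> R) (x : I) : x \in A -> P x -> (forall y, y \in A -> P y -> y = x) ->
  \sum_(y <- A | P y) F y = F x.
Proof.
move=> xA Px H; rewrite big_mkcond (big_fsetD1 x) //= Px big1_seq ?addr0 // => y.
rewrite in_fsetD1 /= => /andP[nyx yA]; case: ifP => // /(H _ yA) e.
by rewrite e eqxx in nyx.
Qed.

Lemma big_seq_reindex (R : nmodType) (I J : eqType) (s : seq I) (r : seq J)
  (P : pred I) (Q : pred J) (h : I -> J) (F : J -> R) :
  uniq s -> uniq r ->
  {in [pred i | P i & i \in s] &, injective h} ->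
  (forall i, i \in s -> P i -> h i \in r /\ Q (h i)) ->
  (forall j, j \in r -> Q j -> exists i, [/\ i \in s, P i & j = h i]) ->
  \sum_(j <- r | Q j) F j = \sum_(i <- s | P i) F (h i).
Proof.
move=> us ur injh hP hQ; rewrite -big_filter -[RHS]big_filter -(big_map h predT F).
apply/perm_big/uniq_perm; first exact: filter_uniq.
  rewrite map_inj_in_uniq ?filter_uniq // => x y; rewrite !mem_filter.
  exact: injh.
move=> j; rewrite mem_filter; apply/andP/mapP => [[Qj jr]|[i]].
  have [i [si Pi ->]] := hQ j jr Qj; exists i => //.
  by rewrite mem_filter Pi.
by rewrite mem_filter => /andP[Pi si] ->; have [] := hP i si Pi.
Qed.

Section Expansion.
Variables (U : {fset cell}) (N : nat) (R : comNzRingType) (w : cell -> R).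
Hypotheses (iU : ideal U) (boundU : forall u, u \in U -> (u.1 <= N)%N).
Local Notation Z := (@excited_sum U N R w).
Local Notation K := (@row_weight R N).

(* The vertical step of row i of the boundary of L is at position b - i, the
   horizontal step of column j at position j - 1 - a. *)
Definition edge_labelling (L : {fset cell}) (tau : int -> R) : Prop :=
  forall i j a b, (i, j) \in L -> (i, b) \in L -> (i, b.+1) \notin L ->
    (a, j) \in L -> (a.+1, j) \notin L ->
  w (i, j) * tau (b%:Z - i%:Z) = tau (j%:Z - 1 - a%:Z).

(** The steps of a given row and column sit, in the boundary without [c], at the swapped positions
    of those in the boundary of [L]; the relation for each remaining cell is thus inherited. *)
Lemma edge_labelling_corner L c tau : ideal L -> removable L c ->
  edge_labelling L tau ->
  edge_labelling (L `\ c)%fset (tau \o swap_content (content c)).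
Proof.
move=> iL rc E i j a b; have [cL _] := rc; have pc := proj1 iL c cL.
have inD x : x \in (L `\ c)%fset -> x != c /\ x \in L.
  by rewrite in_fsetD1 => /andP[].
have notinD x : x \notin (L `\ c)%fset -> (x == c) || (x \notin L).
  by rewrite in_fsetD1; case: (x == c).
move=> /inD[nij ijL] /inD[nib ibL] /notinD ib1 /inD[naj ajL] /notinD a1j.
have pij := proj1 iL _ ijL; have pib := proj1 iL _ ibL; have paj := proj1 iL _ ajL.
have inL x y : (0 < x)%N -> (0 < y)%N -> (x <= c.1)%N -> (y <= c.2)%N -> (x, y) \in L.
  by move=> x0 y0 xc yc; apply: (proj2 iL) cL _ _; cell_lia.
have maxL x y : (x, y) \in L -> (c.1 <= x)%N -> (c.2 <= y)%N -> x = c.1 /\ y = c.2.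
  move=> xyL cx cy; have /(_ ltac:(cell_lia) pc) e := removable_max rc xyL.
  by rewrite -e.
have dec x y z t : (x, y) \in L -> (0 < z)%N -> (0 < t)%N -> (z <= x)%N -> (t <= y)%N ->
    (z, t) \in L.
  by move=> xyL z0 t0 zx ty; apply: (proj2 iL) xyL _ _; cell_lia.
have ia : (i <= a)%N.
  rewrite leqNgt; apply/negP => ai; case/orP: a1j => [/eqP e|/negP[]].
    have [e1 e2] : a.+1 = c.1 /\ j = c.2 by rewrite -e.
    clear e.
    have [] := maxL _ _ ijL ltac:(cell_lia) ltac:(cell_lia) => ? ?.
    by move: nij; rewrite cell_eqE /=; cell_lia.
  by apply: dec ijL _ _ _ _; cell_lia.
have jb : (j <= b)%N.
  rewrite leqNgt; apply/negP => bj; case/orP: ib1 => [/eqP e|/negP[]].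
    have [e1 e2] : i = c.1 /\ b.+1 = c.2 by rewrite -e.
    clear e.
    have [] := maxL _ _ ijL ltac:(cell_lia) ltac:(cell_lia) => ? ?.
    by move: nij; rewrite cell_eqE /=; cell_lia.
  by apply: dec ijL _ _ _ _; cell_lia.
(* In the row of [c] the step is at [content c - 1] after removal and at [content c] before; the
   steps of other rows stay in place and avoid both positions. The columns are treated in the same
   way below. *)
have vert : exists b', [/\ (i, b') \in L, (i, b'.+1) \notin L &
    swap_content (content c) (b%:Z - i%:Z) = b'%:Z - i%:Z].
  have [eic|nic] := eqVneq i c.1.
    have bc : (b < c.2)%N.
      rewrite ltnNge; apply/negP => cb; have [] := maxL _ _ ibL ltac:(cell_lia) cb => ? ?.
      by move: nib; rewrite cell_eqE /=; cell_lia.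
    have eb : b.+1 = c.2.
      by case/orP: ib1 => [/eqP <-|/negP[]] //; apply: inL; cell_lia.
    exists b.+1; rewrite eb eic -surjective_pairing cL; split=> //.
      by apply/negP => /maxL; cell_lia.
    by rewrite /swap_content /content; do !case: eqP => //; cell_lia.
  have ib1L : (i, b.+1) \notin L.
    case/orP: ib1 => // /eqP e.
    by have [e1 _] : i = c.1 /\ b.+1 = c.2; [rewrite -e | rewrite e1 eqxx in nic].
  exists b; split=> //; rewrite /swap_content /content.
  have [ic|ci] := ltnP i c.1.
    have cb : (c.2 <= b)%N.
      by rewrite leqNgt; apply: contra ib1L => bc; apply: inL; cell_lia.
    by do !case: eqP => //; cell_lia.
  have bc : (b < c.2)%N.
    by rewrite ltnNge; apply/negP => cb; have := maxL _ _ ibL ci cb; cell_lia.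
  by do !case: eqP => //; cell_lia.
have hor : exists a', [/\ (a', j) \in L, (a'.+1, j) \notin L &
    swap_content (content c) (j%:Z - 1 - a%:Z) = j%:Z - 1 - a'%:Z].
  have [ejc|njc] := eqVneq j c.2.
    have ac : (a < c.1)%N.
      rewrite ltnNge; apply/negP => ca; have [] := maxL _ _ ajL ca ltac:(cell_lia) => ? ?.
      by move: naj; rewrite cell_eqE /=; cell_lia.
    have ea : a.+1 = c.1.
      by case/orP: a1j => [/eqP <-|/negP[]] //; apply: inL; cell_lia.
    exists a.+1; rewrite ea ejc -surjective_pairing cL; split=> //.
      by apply/negP => /maxL; cell_lia.
    by rewrite /swap_content /content; do !case: eqP => //; cell_lia.
  have a1jL : (a.+1, j) \notin L.
    case/orP: a1j => // /eqP e.
    by have [_ e2] : a.+1 = c.1 /\ j = c.2; [rewrite -e | rewrite e2 eqxx in njc].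
  exists a; split=> //; rewrite /swap_content /content.
  have [jc|cj] := ltnP j c.2.
    have ca : (c.1 <= a)%N.
      by rewrite leqNgt; apply: contra a1jL => ac; apply: inL; cell_lia.
    by do !case: eqP => //; cell_lia.
  have ac : (a < c.1)%N.
    by rewrite ltnNge; apply/negP => ca; have := maxL _ _ ajL ca cj; cell_lia.
  by do !case: eqP => //; cell_lia.
have [b' [bL' b1L' eb]] := vert; have [a' [aL' a1L' ea]] := hor.
by rewrite /= eb ea; apply: E.
Qed.

Lemma edge_labelling_at_corner L c tau : ideal L -> removable L c ->
  edge_labelling L tau -> w c * tau (content c) = tau (content c - 1).
Proof.
move=> iL rc E; have [cL _] := rc; have pc := proj1 iL c cL.
have -> : content c - 1 = c.2%:Z - 1 - c.1%:Z by rewrite /content; lia.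
rewrite [X in w X]surjective_pairing; apply: E; rewrite -?surjective_pairing //.
  by apply/negP => h; have /eqP := removable_max rc h ltac:(cell_lia) pc; cell_lia.
by apply/negP => h; have /eqP := removable_max rc h ltac:(cell_lia) pc; cell_lia.
Qed.

(** * Effect of removing a corner of L on one term of the expansion *)

Section Corner.
Variables (L : {fset cell}) (c : cell) (tau : int -> R).
Hypotheses (iL : ideal L) (LU : {subset L <= U}) (rc : removable L c).
Hypothesis tauL : edge_labelling L tau.
Let L' := (L `\ c)%fset.
Let tau' := tau \o swap_content (content c).
Let F' A := K tau' A * Z L' A.

(* Each of the two sums over v has at most one term. *)
Lemma expansion_term_corner A : ideal A -> {subset A <= U} ->
  K tau A * Z L A - F' A = (1 - w c) *
    (\sum_(v <- U | same_diag v c && `[< removable A v >]) F' (A `\ v)%fset -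
     \sum_(v <- U | same_diag v c && `[< addable A v >]) F' A).
Proof.
move=> iA AU; have [cL iL'] := rc; have pc := proj1 iL c cL; have cU := LU cL.
have wc := edge_labelling_at_corner iL rc tauL.
have content_eq v : same_diag v c -> content v = content c.
  by rewrite /content; cell_lia.
have [[v [rv dv]]|nr] := pselect (exists v, removable A v /\ same_diag v c).
  have [vA iAv] := rv; have av := removable_addable iA rv.
  rewrite (@big_fset_uniq1 _ _ _ _ _ v) ?AU //; first last.
  - move=> u uU /andP[du /asboolP ru].
    by apply: (removable_uniq iA) => //; move: du dv; cell_lia.
  - by rewrite dv; apply/asboolP.
  rewrite big1_seq ?subr0; last first.
    move=> u /andP[/andP[du /asboolP au] _]; exfalso.
    by apply: (addable_not_removable iA au rv); move: du dv; cell_lia.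
  have [X []] := row_weight_addable tau iAv av (boundU (AU _ vA)).
  rewrite fsetD1K // content_eq // => e1 e2 e3 e4.
  rewrite /F' (excited_sum_corner w boundU iL iA LU AU rc rv dv) e2 e3 e4 -wc; ring.
have nrem v : same_diag v c -> ~ removable A v by move=> dv rv; case: nr; exists v.
have ZE : Z L A = Z L' A.
  by rewrite [RHS]excited_sum_nocorner // => v rv dv; case: (nrem v).
rewrite [X in _ * (X - _)]big1_seq ?sub0r; last first.
  by move=> v /andP[/andP[dv /asboolP rv] _]; case: (nrem v).
rewrite /F' ZE -mulrBl.
have [[v [av dv]]|na] := pselect (exists v, addable A v /\ same_diag v c).
  (* If [v] is outside [U], the sum over [U] misses it. In that case [v] lies beyond [c], so [A]
     contains [c] and [Z L' A] is 0. *)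
  have [vU|nvU] := boolP (v \in U); last first.
    have pv := addable_pos av.
    have cA : c \in A.
      have cv : cell_le c v.
        case/orP: (diag_total dv) => // vc; case/negP: nvU.
        exact: (proj2 iU) cU pv vc.
      by apply: addable_below av pc cv _; apply: contraNneq nvU => <-.
    have -> : Z L' A = 0.
      by apply: excited_sum_nsub => // /(_ c cA); rewrite !in_fsetD1 eqxx.
    by rewrite !mulr0 big1 ?oppr0 ?mulr0.
  rewrite (@big_fset_uniq1 _ _ _ _ _ v) //; first last.
  - by move=> u uU /andP[du /asboolP au]; apply: (addable_uniq au av); move: du dv; cell_lia.
  - by rewrite dv; apply/asboolP.
  have [X []] := row_weight_addable tau iA av (boundU vU).
  rewrite content_eq // => e1 e2 e3 e4.
  rewrite e1 e3 -wc; ring.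
have nadd v : same_diag v c -> ~ addable A v by move=> dv av; case: na; exists v.
rewrite big1_seq ?oppr0 ?mulr0; last first.
  by move=> v /andP[/andP[dv /asboolP av] _]; case: (nadd v).
rewrite row_weight_swap ?subrr ?mul0r //; last exact: boundU.
by move=> u /AU /boundU.
Qed.

End Corner.

(** * Sums over the ideals containing M *)

Definition ideal_over (M A : {fset cell}) : bool := `[< ideal A >] && (M `<=` A)%fset.

Lemma sum_removable M v (F : {fset cell} -> R) :  v \in U ->
  \sum_(A <- fpowerset U | ideal_over M A && `[< removable A v >]) F (A `\ v)%fset =
  \sum_(A <- fpowerset U |
     [&& `[< ideal A >], `[< addable A v >] & (M `<=` v |` A)%fset]) F A.
Proof.
move=> vU; apply/esym/big_seq_reindex; rewrite ?fset_uniq //.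
- move=> A B; rewrite !inE /= => /andP[/andP[_ /asboolP[vA _]] _].
  by move=> /andP[/andP[_ /asboolP[vB _]] _] e; rewrite -(fsetD1K vA) -(fsetD1K vB) e.
- move=> A; rewrite !fpowersetE => AU /andP[/andP[/asboolP iA MA] /asboolP rv].
  split; first exact: fsubset_trans (fsubD1set _ _) AU.
  have [vA iAv] := rv; rewrite fsetD1K // MA andbT.
  by apply/andP; split; apply/asboolP => //; apply: removable_addable.
move=> A; rewrite fpowersetE => AU /and3P[/asboolP iA /asboolP av MA].
exists (v |` A)%fset; split; last by rewrite fsetU1K //; case: av.
  by rewrite fpowersetE fsubUset fsub1set vU.
rewrite /ideal_over MA andbT; apply/andP; split; apply/asboolP; first by case: av.
exact: addable_removable.
Qed.

(** The left-hand difference runs over the ideals [A] that have [v] addable and contain [M] only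
    after [v] is added. This forces [v] to be a corner of [M]. Conversely, for such a corner, [v] is
    addable to every ideal containing the rest of [M] but not [v]. *)
Lemma sum_addable_diff M v (F : {fset cell} -> R) : ideal M ->
  \sum_(A <- fpowerset U |
     [&& `[< ideal A >], `[< addable A v >] & (M `<=` v |` A)%fset]) F A -
  \sum_(A <- fpowerset U | ideal_over M A && `[< addable A v >]) F A =
  if `[< removable M v >] then
    \sum_(A <- fpowerset U | ideal_over (M `\ v)%fset A) F A -
    \sum_(A <- fpowerset U | ideal_over M A) F A
  else 0.
Proof.
move=> iM; rewrite (bigID (fun A => (M `<=` A)%fset)) /=.
have -> : \sum_(A <- fpowerset U |
     [&& `[< ideal A >], `[< addable A v >] & (M `<=` v |` A)%fset] &&
     (M `<=` A)%fset) F A =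
  \sum_(A <- fpowerset U | ideal_over M A && `[< addable A v >]) F A.
  apply: eq_bigl => A; rewrite /ideal_over; case: (boolP (M `<=` A)%fset) => MA.
    by rewrite (fsubset_trans MA (fsubsetU1 _ _)) !andbT.
  by rewrite !andbF.
rewrite addrAC subrr add0r.
case: ifP => [/asboolP rv|/negP nrv]; last first.
  apply: big1_seq => A /andP[/andP[/and3P[/asboolP iA /asboolP av MvA] nMA] _].
  case: nrv; apply/asboolP; apply: removableP => // [|u uM vu].
    apply: contraNT nMA => vM; apply/fsubsetP => u uM.
    have := fsubsetP MvA u uM; rewrite in_fset1U => /orP[/eqP e|//].
    by rewrite -e uM in vM.
  have := fsubsetP MvA u uM; rewrite in_fset1U => /orP[/eqP //|uA].
  by have [/negP[]] := av; apply: (proj2 iA) uA (addable_pos av) vu.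
have [vM iMv] := rv.
rewrite [in RHS](bigID (fun A => (M `<=` A)%fset)) /=.
have -> : \sum_(A <- fpowerset U | ideal_over (M `\ v)%fset A && (M `<=` A)%fset) F A =
          \sum_(A <- fpowerset U | ideal_over M A) F A.
  apply: eq_bigl => A; rewrite /ideal_over -andbA; congr (_ && _).
  by case: (boolP (M `<=` A)%fset) => [/(fsubset_trans (fsubD1set _ _))->|]; rewrite ?andbF.
rewrite addrAC subrr add0r; apply: eq_bigl => A; rewrite /ideal_over.
rewrite fsubDset; case: asboolP => //= iA.
case: (boolP (M `<=` v |` A)%fset) => MvA; rewrite ?andbF // !andbT.
have [MA|nMA] := boolP (M `<=` A)%fset; rewrite ?andbF //= andbT.
have MA u : u \in M -> u != v -> u \in A.
  by move=> /(fsubsetP MvA); rewrite in_fset1U => /orP[->|].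
apply/asboolP; apply: addableP => //.
- apply: contra nMA => vA; apply/fsubsetP => u uM.
  by have [->//|/MA->] := eqVneq u v.
- exact: (proj1 iM).
by move=> u pu uv nuv; apply: MA => //; apply: (proj2 iM) vM pu uv.
Qed.

(** Induction on the size of [L], removing a corner [c]. Both sides are compared with their
    analogues for [L']: by [expansion_term_corner], after exchanging the sums over [A] and [v], the
    right-hand side changes by differences of sums over [M] without [v] and over [M], to which the
    induction hypothesis applies. *)
Theorem expansion L tau : ideal L -> {subset L <= U} -> edge_labelling L tau ->
  forall M, ideal M -> {subset M <= U} ->
  K tau L * Z L M = \sum_(A <- fpowerset U | ideal_over M A) K tau A * Z L A.
Proof.
have [n] := ubnP #|` L|; elim: n => // n IH in L tau * => ltn iL LU tauL M iM MU.
have [L0|nL0] := eqVneq L fset0.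
  have Z0 A : ideal A -> A != fset0 -> Z L A = 0.
    move=> iA /fset0Pn[u uA]; apply: excited_sum_nsub => // /(_ u uA).
    by rewrite L0 in_fset0.
  have [M0|nM0] := eqVneq M fset0; last first.
    rewrite Z0 // mulr0 big1 // => A /andP[/asboolP iA MA].
    rewrite Z0 ?mulr0 //; apply: contraNneq nM0 => A0.
    by rewrite A0 fsubset0 in MA.
  rewrite M0 big_mkcond (big_fsetD1 fset0) ?fpowersetE ?fsub0set //=.
  rewrite /ideal_over fsub0set andbT ifT; last by apply/asboolP/ideal0.
  rewrite L0 big1_seq ?addr0 // => A /=; rewrite in_fsetD1 => /andP[A0 _].
  by rewrite -L0; case: ifP => // /andP[/asboolP iA _]; rewrite Z0 ?mulr0.
have [c rc] := ex_removable iL nL0; have [cL iL'] := rc.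
set L' := (L `\ c)%fset in iL'; pose tau' := tau \o swap_content (content c).
pose C := K tau L; pose F' A := K tau' A * Z L' A.
have L'U : {subset L' <= U} by move=> u; rewrite in_fsetD1 => /andP[_ /LU].
(* The vertical step moved by the removal of [c] keeps its label, since the labels are swapped
   too. *)
have CE : K tau' L' = C.
  have [] := row_weight_addable tau iL' (removable_addable iL rc) (boundU (LU _ cL)).
  by move=> X [_ + + _]; rewrite fsetD1K // /C /tau' => -> ->.
have IH' A : ideal A -> {subset A <= U} ->
    \sum_(B <- fpowerset U | ideal_over A B) F' B = C * Z L' A.
  move=> iA AU; rewrite -CE; apply/esym/IH => //; last exact: edge_labelling_corner.
  have lt : (#|` L'| < #|` L|)%N by rewrite [ltnRHS](cardfsD1 c) cL add1n ltnS.
  exact: leq_trans lt ltn.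
(* The corner recursion, with its two cases merged into a sum over [v] having at most one term. *)
have -> : C * Z L M = C * Z L' M + C * (1 - w c) *
    \sum_(v <- U | same_diag v c && `[< removable M v >])
       (Z L' (M `\ v)%fset - Z L' M).
  have [[v [rv dv]]|nr] := pselect (exists v, removable M v /\ same_diag v c).
    rewrite (@big_fset_uniq1 _ _ _ _ _ v); first last.
    - move=> u uU /andP[du /asboolP ru].
      by apply: (removable_uniq iM) => //; move: du dv; cell_lia.
    - by rewrite dv; apply/asboolP.
    - by apply: MU; case: rv.
    by rewrite (excited_sum_corner w boundU iL iM LU MU rc rv dv); ring.
  rewrite big1_seq ?mulr0 ?addr0; last first.
    by move=> v /andP[/andP[dv /asboolP rv] _]; case: nr; exists v.
  by rewrite [in RHS]excited_sum_nocorner // => v rv dv; case: nr; exists v.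
rewrite -IH' //; apply/eqP; rewrite eq_sym addrC -subr_eq -sumrB; apply/eqP.
rewrite big_seq_cond.
under eq_bigr => A /andP[].
  rewrite fpowersetE => /fsubsetP AU /andP[/asboolP iA _].
  rewrite (expansion_term_corner iL LU rc tauL iA AU).
over.
rewrite -big_seq_cond -big_distrr [C * _]mulrC -mulrA /=; congr (_ * _).
rewrite sumrB !(exchange_big_dep (fun v => same_diag v c)) /=;
  try by move=> A v _ /andP[].
rewrite -sumrB big_mkcondr big_distrr /= big_seq_cond [RHS]big_seq_cond.
apply: eq_bigr => v /andP[vU dv]; rewrite dv /=.
rewrite (sum_removable M F' vU) (sum_addable_diff v F' iM).
case: asboolP => [[vM iMv]|_]; last by rewrite mulr0.
rewrite !IH' ?mulrBr // => u; rewrite in_fsetD1 => /andP[_]; exact: MU.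
Qed.

End Expansion.

(** * Excited diagrams and their peaks *)

Section Excited.
Local Open Scope nat_scope.
Variables (la mu : seq nat) (N : nat).
Local Notation L := (young la).
Local Notation M := (young mu).
Hypotheses (iL : ideal L) (iM : ideal M) (ML : {subset M <= L}).
Hypothesis boundL : forall u, u \in L -> u.1 <= N.
Local Notation filling := {ffun L -> 'I_N.+1}.
Local Notation excited_filling := (excited_filling L M).
Implicit Types (t : filling).

Definition diagram t : {fset cell} := [fset shift v (ev t v) | v in M]%fset.

Definition peak_seq t : seq cell :=
  [seq shift v s | v <- M, s <- index_iota (low t v) (ev t v)].

Definition peak_set t : {fset cell} := [fset u in peak_seq t]%fset.

Lemma diagramP t u :
  reflect (exists2 v, v \in M & u = shift v (ev t v)) (u \in diagram t).
Proof. exact: imfsetP. Qed.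

Lemma peak_setP t u :
  reflect (exists v s, [/\ v \in M, low t v <= s < ev t v & u = shift v s])
    (u \in peak_set t).
Proof.
rewrite inE /=; apply: (iffP allpairsPdep) => [] [v [s [vM sv ->]]]; exists v, s;
  split=> //; move: sv; rewrite mem_index_iota //.
Qed.

Lemma excited_filling_le t u v : excited_filling t -> u \in M -> v \in M ->
  cell_le u v -> ev t u <= ev t v.
Proof. by case=> _ + _; apply. Qed.

(** If [u] is strictly northwest of [v] on their diagonal, then s < [ev t u] <= [low t v] <= s',
    whereas equal positions would require s > s'. *)
Lemma peak_inj t u v s s' : excited_filling t -> u \in M -> v \in M ->
  low t u <= s < ev t u -> low t v <= s' < ev t v -> shift u s = shift v s' ->
  u = v /\ s = s'.
Proof.
move=> vt uM vM su sv /shift_eq [e1 e2].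
have [lt|gt|eq] := ltngtP u.1 v.1; last by split; [apply: cell_eqP|]; cell_lia.
  by have := low_le iM vt vM uM ltac:(cell_lia) ltac:(cell_lia); cell_lia.
by have := low_le iM vt uM vM ltac:(cell_lia) ltac:(cell_lia); cell_lia.
Qed.

Lemma peak_seq_uniq t : excited_filling t -> uniq (peak_seq t).
Proof.
move=> vt; apply: allpairs_uniq_dep; rewrite ?fset_uniq //.
  by move=> v _; apply: iota_uniq.
move=> p p' /allpairsPdep[u [s [uM su ->]]] /allpairsPdep[v [s' [vM sv ->]]] /= e.
rewrite !mem_index_iota in su sv.
by have [-> ->] := peak_inj vt uM vM su sv e.
Qed.

Lemma diagram_inj_cell t u v : excited_filling t -> u \in M -> v \in M ->
  shift u (ev t u) = shift v (ev t v) -> u = v.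
Proof.
move=> vt uM vM /shift_eq [e1 e2].
have [lt|gt|eq] := ltngtP u.1 v.1; last by apply: cell_eqP; cell_lia.
  by have := excited_filling_le vt uM vM ltac:(cell_lia); cell_lia.
by have := excited_filling_le vt vM uM ltac:(cell_lia); cell_lia.
Qed.

(** Induction on the row. If [t] has the smaller value at [u], the final position of [u] under [t]
    is reached under [t'] by some [v]. In an earlier row [v] has the same value in [t], a collision;
    otherwise [v] is southeast of [u] and has moved too far. The other case is symmetric. *)
Lemma diagram_inj t t' : excited_filling t -> excited_filling t' ->
  diagram t = diagram t' -> t = t'.
Proof.
move=> vt vt' e.
suff H k u : u \in M -> u.1 < k -> ev t u = ev t' u.
  apply: ev_inj => u uL; have [uM|nM] := boolP (u \in M); first exact: H (ltnSn _).
  by have [-> // _ _] := vt; have [-> // _ _] := vt'.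
elim: k u => // k IH u uM uk.
have [//|] := eqVneq (ev t u) (ev t' u); rewrite neq_ltn => /orP[lt|lt].
  have : shift u (ev t u) \in diagram t' by rewrite -e; apply/diagramP; exists u.
  case/diagramP => v vM /[dup] e' /shift_eq[e1 e2].
  have [ltv|gev] := ltnP v.1 u.1.
    by have := IH v vM (leq_trans ltv uk) => h; rewrite -h in e';
       move: ltv; rewrite (diagram_inj_cell vt uM vM e') ltnn.
  by have := excited_filling_le vt' uM vM ltac:(cell_lia); cell_lia.
have : shift u (ev t' u) \in diagram t by rewrite e; apply/diagramP; exists u.
case/diagramP => v vM /[dup] e' /shift_eq[e1 e2].
have [ltv|gev] := ltnP v.1 u.1.
  by have := IH v vM (leq_trans ltv uk) => h; rewrite h in e';
     move: ltv; rewrite (diagram_inj_cell vt' uM vM e') ltnn.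
by have := excited_filling_le vt uM vM ltac:(cell_lia); cell_lia.
Qed.

(** * One excited move as an increment of the filling *)

Section Step.
Variables (t1 t : filling) (x : cell).
Hypotheses (vt1 : excited_filling t1) (vt : excited_filling t) (xM : x \in M).
Hypothesis tE : forall u, ev t u = ev t1 u + (u == x).
Let k := ev t1 x.
Let u0 := shift x k.

Let tx : ev t x = k.+1.
Proof. by rewrite tE eqxx addn1. Qed.
Let tne v : v != x -> ev t v = ev t1 v.
Proof. by rewrite tE => /negPf ->; rewrite addn0. Qed.
Let le_xv v : v \in M -> cell_le x v -> k < ev t v.
Proof. by move=> vM xv; rewrite -tx; apply: excited_filling_le. Qed.
Let le_vx v : v \in M -> cell_le v x -> ev t1 v <= k.
Proof. by move=> vM xv; apply: excited_filling_le. Qed.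

(** Other cells of [M] southeast of [x] have moved more than [k] times and those northwest at most
    [k] times, by monotonicity of [t] and [t1]. Cells incomparable with [x] lie on diagonals too far
    away to meet the square at [u0]. *)
Lemma excited_step_active : active la (diagram t1) u0.
Proof.
have px := proj1 iM x xM; have [_ _ /(_ x xM) seL] := vt; rewrite tx in seL.
have inL i j : 0 < i -> 0 < j -> i <= x.1 + k.+1 -> j <= x.2 + k.+1 -> (i, j) \in L.
  by move=> i0 j0 ix jx; apply: (proj2 iL) seL _ _; cell_lia.
have free i j : x.1 + k <= i -> x.2 + k <= j -> i <= x.1 + k.+1 -> j <= x.2 + k.+1 ->
    (i, j) != u0 -> (i, j) \in (L `\` diagram t1)%fset.
  move=> xi xj ix jx nij; rewrite in_fsetD inL ?andbT; [|cell_lia..].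
  apply/diagramP => -[v vM e].
  have [e1 e2] : i = v.1 + ev t1 v /\ j = v.2 + ev t1 v by case: e.
  have [evx|nvx] := eqVneq v x.
    by case/negP: nij; rewrite /u0 cell_eqE; move: e1 e2; rewrite evx -/k; cell_lia.
  have tv := tne nvx.
  have [vx|nvx'] := boolP (cell_le v x); first by have := le_vx vM vx; cell_lia.
  have [xv|nxv] := boolP (cell_le x v); first by have := le_xv vM xv; cell_lia.
  cell_lia.
apply/and4P; split.
- by apply/diagramP; exists x.
- by apply: free; rewrite /u0; cell_lia.
- by apply: free; rewrite /u0; cell_lia.
- by apply: free; rewrite /u0; cell_lia.
Qed.

Lemma excited_step_diagram : diagram t = excited_move u0 (diagram t1).
Proof.
apply/fsetP => u; rewrite /excited_move in_fset1U in_fsetD1.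
apply/diagramP/orP => [[v vM ->]|[/eqP ->|/andP[nu /diagramP[v vM e]]]].
- have [->|nvx] := eqVneq v x; first by left; rewrite tx /u0; cell_lia.
  right; rewrite tne //; apply/andP; split; last by apply/diagramP; exists v.
  by apply: contra nvx => /eqP /(diagram_inj_cell vt1 vM xM) ->.
- by exists x => //; rewrite tx /u0; apply: cell_eqP; cell_lia.
exists v => //; rewrite tne //; apply: contraNneq nu => evx.
by rewrite e evx.
Qed.

(** The new level [k] of [x] contributes [u0]. The only lower bounds that can rise are those of the
    east and south neighbours of [x], which lose at most their level [k]: these are the two peaks
    erased by the move. *)
Lemma excited_step_peaks : peak_set t = move_peaks u0 (peak_set t1).
Proof.
have px := proj1 iM x xM.
have lowx : low t x = low t1 x.
  by rewrite /low !tne //; cell_lia.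
have lowge v : low t1 v <= low t v.
  rewrite /low geq_max !leq_max !tE; cell_lia.
apply/fsetP => u; rewrite /move_peaks in_fset1U in_fsetD in_fset2 negb_or.
apply/peak_setP/orP => [[v [s [vM sv ->]]]|].
  have [evx|nvx] := eqVneq v x.
    rewrite evx lowx tx in sv *.
    have [esk|nsk] := eqVneq s k; first by left; rewrite esk.
    right; apply/andP; split; first by rewrite /u0; cell_lia.
    by apply/peak_setP; exists x, s; split=> //; rewrite -/k; cell_lia.
  have tv := tne nvx.
  right; apply/andP; split; last first.
    by apply/peak_setP; exists v, s; split=> //; have := lowge v; cell_lia.
  have pv := proj1 iM v vM.
  have [vx|nvx'] := boolP (cell_le v x).
    by have := le_vx vM vx; rewrite /u0; cell_lia.
  have [xv|nxv] := boolP (cell_le x v).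
    have := low_le iM vt vM xM xv ltac:(cell_lia); rewrite tx /u0; cell_lia.
  rewrite /u0; cell_lia.
case=> [/eqP ->|/andP[nu /peak_setP[v [s [vM sv e]]]]].
  exists x, k; split=> //; rewrite tx lowx ltnSn andbT.
  exact: excited_filling_low vt1 xM.
exists v, s; split=> //; rewrite e in nu.
have [evx|nvx] := eqVneq v x.
  by rewrite evx lowx tx; move: sv; rewrite evx -/k; cell_lia.
rewrite tne //; move: sv => /andP[ls ->]; rewrite andbT.
move: ls; rewrite /low !geq_max !tE => /andP[l1 l2].
have pv := proj1 iM v vM; rewrite /u0 /east /south in nu.
apply/andP; split.
  have [e1|n1] := eqVneq (v.1, v.2.-1) x; last by rewrite addn0.
  have [f1 f2] : x.1 = v.1 /\ x.2 = v.2.-1 by rewrite -e1.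
  by rewrite e1 -/k in l1 *; move: nu; cell_lia.
have [e1|n1] := eqVneq (v.1.-1, v.2) x; last by rewrite addn0.
have [f1 f2] : x.1 = v.1.-1 /\ x.2 = v.2 by rewrite -e1.
by rewrite e1 -/k in l2 *; move: nu; cell_lia.
Qed.

End Step.

(** Induction on the total number of moves. The last move is undone at a minimal cell [x] with
    positive value: all cells northwest of it have value 0, so lowering [x] by one preserves
    monotonicity. *)
Lemma peaks_of_filling t : excited_filling t -> peaks la mu (diagram t) (peak_set t).
Proof.
have [n] := ubnP (\sum_(u <- M) ev t u); elim: n => // n IH in t * => lt vt.
have [t0 tm tL] := vt.
have [[y [yM ty]]|no] := pselect (exists y, y \in M /\ 0 < ev t y); last first.
  have e0 u : ev t u = 0.
    have [uM|/t0//] := boolP (u \in M).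
    by apply/eqP; rewrite -leqn0 leqNgt; apply/negP => h; apply: no; exists u.
  have -> : diagram t = M.
    apply/fsetP => u; apply/diagramP/idP => [[v vM ->]|uM].
      by rewrite e0 /shift !addn0 -surjective_pairing.
    by exists u => //; rewrite e0 /shift !addn0 -surjective_pairing.
  have -> : peak_set t = fset0.
    apply/fsetP => u; rewrite in_fset0; apply/peak_setP => -[v [s [_ + _]]].
    by rewrite e0 ltn0 andbF.
  exact: peaks_start.
have [x [xM tx xmin]] : exists x, [/\ x \in M, 0 < ev t x &
    forall u, u \in M -> cell_le u x -> u != x -> ev t u = 0].
  have [m] := ubnP (y.1 + y.2); elim: m => // m IHm in y yM ty * => ltm.
  have [[z [zM tz zy nzy]]|nz] := pselect (exists z, [/\ z \in M, 0 < ev t z, cell_le z y & z != y]).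
    by apply: (IHm z zM tz); move: zy nzy ltm; cell_lia.
  exists y; split=> // u uM uy nuy; apply/eqP; rewrite -leqn0 leqNgt.
  by apply/negP => tu; apply: nz; exists u.
have xL := ML xM; have px := proj1 iM x xM.
pose t1 := upd t x (ev t x).-1.
have tE u : ev t u = ev t1 u + (u == x).
  rewrite ev_upd //; last by have := ev_le t x; lia.
  by have [->|_] := eqVneq u x; rewrite ?addn0 // addn1 prednK.
have vt1 : excited_filling t1.
  split=> [u uM|u v uM vM uv|u uM].
  - by have := t0 u uM; rewrite tE => /eqP; rewrite addn_eq0 => /andP[/eqP].
  - have := tm _ _ uM vM uv; rewrite !tE.
    have [evx|nvx] := eqVneq v x; last by have [_|_] := eqVneq u x; lia.
    have [eux|nux] := eqVneq u x; first by rewrite evx eux.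
    by rewrite evx in uv; have := xmin u uM uv nux; rewrite tE; lia.
  - have pu := proj1 iM u uM; apply: (proj2 iL) (tL u uM) _ _; first by cell_lia.
    by rewrite (tE u); cell_lia.
rewrite (excited_step_diagram vt1 xM tE) (excited_step_peaks vt1 vt xM tE).
apply: peaks_step; last exact: excited_step_active vt1 vt xM tE.
apply: IH => //; rewrite -ltnS; apply: leq_trans lt.
rewrite ltnS [in ltnRHS](eq_bigr _ (fun u _ => tE u)) big_split /=.
by rewrite [X in _ + X](big_fsetD1 x xM) /= eqxx addnA addn1 ltnS leq_addr.
Qed.

(** Raising an active cell [x] could only break monotonicity at some later cell with the same value.
    Then the south or east neighbour of [x] has that value as well, and its position blocks the
    move. *)
Lemma filling_of_excited D : excited la mu D ->
  exists2 t, excited_filling t & D = diagram t.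
Proof.
elim=> [|{}D u _ [t vt ->] au].
  have e0 u : ev (fill L N (fun=> 0)) u = 0.
    by have [uL|nL] := boolP (u \in L); [rewrite ev_fill | rewrite ev_out].
  exists (fill L N (fun=> 0)).
    split=> [u _|u v _ _ _|u uM]; rewrite ?e0 //.
    by rewrite /shift !addn0 -surjective_pairing; apply: ML.
  apply/fsetP => u; apply/idP/diagramP => [uM|[v vM ->]].
    by exists u => //; rewrite e0 /shift !addn0 -surjective_pairing.
  by rewrite e0 /shift !addn0 -surjective_pairing.
have [t0 tm tL] := vt; case/and4P: au => /diagramP[x xM ->] sD eD.
rewrite in_fsetD => /andP[_ seL].
have px := proj1 iM x xM; have xL := ML xM.
have xN : (ev t x).+1 <= N by have := boundL seL; cell_lia.
have tE v : ev (upd t x (ev t x).+1) v = ev t v + (v == x).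
  by rewrite ev_upd //; have [->|_] := eqVneq v x; rewrite ?addn0 ?addn1.
have nD v : v \in M -> ev t v = ev t x -> (v == east x) || (v == south x) -> False.
  move=> vM tv /orP[/eqP e|/eqP e].
    move: eD; rewrite in_fsetD => /andP[/diagramP[]]; exists v => //.
    by rewrite tv e; apply: cell_eqP; rewrite /east /=; cell_lia.
  move: sD; rewrite in_fsetD => /andP[/diagramP[]]; exists v => //.
  by rewrite tv e; apply: cell_eqP; rewrite /south /=; cell_lia.
have vt' : excited_filling (upd t x (ev t x).+1).
  split=> [v vM|v v' vM v'M vv'|v vM]; rewrite !tE.
  - rewrite t0 // add0n; case: eqP => // e; by rewrite e xM in vM.
  - have tvv := tm _ _ vM v'M vv'.
    have [evx|nvx] := eqVneq v x; last by rewrite addn0; apply: leq_trans tvv (leq_addr _ _).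
    have [ev'x|nv'x] := eqVneq v' x; first by rewrite leq_add2r.
    rewrite evx in tvv vv' *; rewrite addn0 addn1 ltn_neqAle tvv andbT.
    apply/eqP => e.
    have H z : z \in M -> cell_le x z -> cell_le z v' -> ev t z = ev t x.
      move=> zM xz zv'; apply/eqP; rewrite eqn_leq (tm _ _ xM zM xz) andbT e.
      exact: tm zv'.
    have [lt|ge] := ltnP x.1 v'.1.
      have sM : south x \in M by apply: (proj2 iM) v'M _ _; rewrite /south; cell_lia.
      by apply: (nD _ sM); rewrite ?eqxx ?orbT // H // /south; cell_lia.
    have eM : east x \in M by apply: (proj2 iM) v'M _ _; rewrite /east; cell_lia.
    by apply: (nD _ eM); rewrite ?eqxx // H // /east; cell_lia.
  - have [->|_] := eqVneq v x; last by rewrite addn0; apply: tL.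
    by move: seL; rewrite /shift /southeast /= addn1 !addnS.
exists (upd t x (ev t x).+1) => //.
by rewrite (excited_step_diagram vt xM tE).
Qed.

End Excited.

(** * Reverse plane partitions *)

Section PlanePartitions.
Variables (U : {fset cell}) (N : nat).
Hypothesis iU : ideal U.
Local Notation filling := {ffun U -> 'I_N.+1}.

Definition weakly_increasing (t : filling) : Prop :=
  forall u v, u \in U -> v \in U -> cell_le u v -> (ev t u <= ev t v)%N.

(** A reverse plane partition of shape U/M, extended by 0 on [M], so that the same filling type
    serves for every [M]. Its entries are at most n, hence the condition n <= N below. *)
Definition rpp_filling (M : {fset cell}) (n : nat) (t : filling) : bool :=
  `[< (forall u, u \in M -> ev t u = 0%N) /\ weakly_increasing t >] &&
  (\sum_(u <- U) ev t u == n)%N.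

Definition rpp_count (n : nat) (M : {fset cell}) : int :=
  \sum_(t | rpp_filling M n t) 1.

Definition zeros (t : filling) : {fset cell} := [fset u in U | ev t u == 0%N]%fset.

Lemma mem_zeros t u : (u \in zeros t) = (u \in U) && (ev t u == 0%N).
Proof. by rewrite !inE. Qed.

Lemma zeros_ideal t : weakly_increasing t -> ideal (zeros t).
Proof.
move=> tm; split=> [u|u v]; rewrite !mem_zeros => /andP[]; first by move/(proj1 iU).
move=> vU /eqP v0 pu uv; have uU := proj2 iU u v vU pu uv.
by rewrite uU -leqn0 -v0 tm.
Qed.

Lemma sum_notin (A : {fset cell}) :
  (\sum_(u <- U) (u \notin A : nat))%N = #|` (U `\` A)%fset|.
Proof.
rewrite card_fset_sum1 -(big_fset_incl _ (fsubsetDl U A)) => [|u uU].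
  by rewrite [LHS]big_seq [RHS]big_seq; apply: eq_bigr => u; rewrite in_fsetD => /andP[->].
by rewrite in_fsetD uU andbT negbK => ->.
Qed.

Lemma rpp_count_full n : rpp_count n U = (n == 0%N)%:R.
Proof.
have E (t : filling) : rpp_filling U n t = (t == fill U N (fun=> 0%N)) && (n == 0%N).
  apply/andP/andP => [[/asboolP[t0 _] /eqP <-]|[/eqP -> /eqP ->]].
    split; last by rewrite big1_seq // => u /andP[_ /t0].
    by apply/eqP/ev_inj => u uU; rewrite t0 // ev_fill.
  have e0 u : ev (fill U N (fun=> 0%N)) u = 0%N.
    by have [uL|nL] := boolP (u \in U); [rewrite ev_fill | rewrite ev_out].
  split; last by rewrite big1.
  by apply/asboolP; split=> [u _|u v _ _ _]; rewrite !e0.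
rewrite /rpp_count (eq_bigl _ _ E); case: eqP => _.
  by rewrite (eq_bigl (fun t => t == fill U N (fun=> 0%N))) ?big_pred1_eq // => t; rewrite andbT.
by rewrite big_pred0 // => t; rewrite andbF.
Qed.

(** Adding 1 off [A] is a bijection from the reverse plane partitions of U/A onto those of U/M with
    zero set exactly [A]; it raises the size by the number of cells off [A]. *)
Lemma rpp_count_zeros n (M A : {fset cell}) : (n <= N)%N -> {subset M <= U} ->
  {subset A <= U} ->
  \sum_(t | rpp_filling M n t && (A == zeros t)) (1 : int) =
  if ideal_over M A && (#|` (U `\` A)%fset| <= n)%N
  then rpp_count (n - #|` (U `\` A)%fset|) A else 0.
Proof.
move=> nN MU AU; set d := #|` (U `\` A)%fset|.
case: ifP => [/andP[/andP[/asboolP iA MA] cn]|nA]; last first.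
  apply: big1 => t /andP[/andP[/asboolP[t0 tm] /eqP tn] /eqP eA]; case/negP: nA.
  apply/andP; split.
    apply/andP; split; first by apply/asboolP; rewrite eA; apply: zeros_ideal.
    by apply/fsubsetP => u uM; rewrite eA mem_zeros t0 // eqxx MU.
  rewrite /d -tn -sum_notin big_seq [leqRHS]big_seq; apply: leq_sum => u uU.
  by rewrite eA mem_zeros uU /=; case: (ev t u).
pose up (t : filling) : filling := fill U N (fun u => ev t u + (u \notin A))%N.
have upE t u : rpp_filling A (n - d) t -> u \in U -> ev (up t) u = (ev t u + (u \notin A))%N.
  move=> /andP[_ /eqP tn] uU; rewrite ev_fill //.
  have [uA|nuA] := boolP (u \in A); first by rewrite addn0 ev_le.
  (* Off [A] the entry is at most n - d with d > 0, so adding 1 does not exceed [N]. *)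
  have : (ev t u <= n - d)%N by rewrite -tn (big_fsetD1 u uU) leq_addr.
  have : (0 < d)%N by rewrite cardfs_gt0; apply/fset0Pn; exists u; rewrite in_fsetD nuA.
  by rewrite /=; lia.
have sumE (t t' : filling) : (forall u, u \in U -> ev t u = ev t' u + (u \notin A))%N ->
    (\sum_(u <- U) ev t u = \sum_(u <- U) ev t' u + d)%N.
  move=> E; rewrite /d -sum_notin -big_split /= big_seq [RHS]big_seq.
  exact: eq_bigr.
apply: (@big_seq_reindex _ _ _ _ _ _ _ up); rewrite ?index_enum_uniq //.
- move=> t t' /andP[Pt _] /andP[Pt' _] e; apply: ev_inj => u uU.
  by have := congr1 (fun t => ev t u) e; rewrite !upE // => /addIn.
- move=> t _ Pt; rewrite mem_index_enum; split=> //.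
  have upEt u := upE t u Pt; have [/asboolP[t0 tm] /eqP tn] := andP Pt.
  apply/andP; split; last first.
    apply/eqP/fsetP => u; rewrite mem_zeros.
    have [uU|nU] := boolP (u \in U); last by apply/negP => /AU; rewrite (negPf nU).
    rewrite upEt // addn_eq0 eqb0 negbK; case: (boolP (u \in A)) => [/t0->//|].
    by rewrite andbF.
  apply/andP; split; last by rewrite (sumE _ t) // tn subnK.
  apply/asboolP; split=> [u uM|u v uU vU uv].
    by have uA := fsubsetP MA u uM; rewrite upEt ?MU // t0 // uA.
  rewrite !upEt //; apply: leq_add; first exact: tm.
  case: (boolP (v \in A)) => [vA|]; last by case: (u \in A).
  by rewrite (proj2 iA u v vA (proj1 iU u uU) uv).
move=> t _ /andP[/andP[/asboolP[t0 tm] /eqP tn] /eqP eA].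
pose t' := fill U N (fun u => (ev t u).-1).
have t'E u : u \in U -> ev t' u = (ev t u).-1.
  by move=> uU; rewrite ev_fill //; have := ev_le t u; lia.
have tE u : u \in U -> (ev t u = ev t' u + (u \notin A))%N.
  move=> uU; rewrite t'E // eA mem_zeros uU /=.
  by case: (ev t u) => //= k; rewrite addn1.
have Pt' : rpp_filling A (n - d) t'.
  apply/andP; split; last first.
    by rewrite -tn (sumE t t' tE) addnK.
  apply/asboolP; split=> [u uA|u v uU vU uv].
    have := uA; rewrite eA mem_zeros => /andP[uU /eqP e]; by rewrite t'E // e.
  by rewrite !t'E //; have := tm u v uU vU uv; lia.
exists t'; split=> //; first exact: mem_index_enum.
by apply: ev_inj => u uU; rewrite upE // tE.
Qed.

Lemma rpp_count_rec n (M : {fset cell}) : (n <= N)%N -> {subset M <= U} ->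
  rpp_count n M = \sum_(A <- fpowerset U | ideal_over M A)
    if (#|` (U `\` A)%fset| <= n)%N then rpp_count (n - #|` (U `\` A)%fset|) A else 0.
Proof.
move=> nN MU; rewrite big_mkcond big_seq.
transitivity (\sum_(A <- fpowerset U | A \in fpowerset U)
    \sum_(t | rpp_filling M n t && (A == zeros t)) (1 : int)); last first.
  apply: eq_bigr => A; rewrite fpowersetE => /fsubsetP AU.
  by rewrite rpp_count_zeros //; case: (ideal_over M A).
rewrite -big_seq /rpp_count.
under [RHS]eq_bigr => A _ do rewrite big_mkcondr.
rewrite exchange_big /=; apply: eq_bigr => t _.
rewrite -big_mkcond /= (@big_fset_uniq1 _ _ _ _ _ (zeros t)) //.
  by rewrite fpowersetE; apply/fsubsetP => u; rewrite mem_zeros => /andP[].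
by move=> A _ /eqP.
Qed.

End PlanePartitions.

(** * From Young diagrams and reverse plane partitions to ideals and fillings *)

Lemma young_ideal la : is_partition la -> ideal (young la).
Proof.
move=> pla; split=> [u|u v]; rewrite !mem_young; first by rewrite /cell_pos => /and3P[-> ->].
move=> /and3P[v1 v2 vp] /andP[-> ->] /andP[uv1 uv2] /=.
by apply: leq_trans uv2 (leq_trans vp _); apply: part_sorted.
Qed.

Section RPPSeries.
Variables (la mu : seq nat).
Hypotheses (hla : is_partition la) (hmu : is_partition mu).
Hypothesis hsub : (young mu `<=` young la)%fset.
Let U := young la.
Let M := young mu.
Let iU : ideal U := young_ideal hla.
Let iM : ideal M := young_ideal hmu.

Definition rpp_of N (t : {ffun U -> 'I_N.+1}) : {ffun Defs.skew la mu -> nat} :=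
  [ffun x => ev t (val x)].

Lemma rpp_of_RPP N n (t : {ffun U -> 'I_N.+1}) : rpp_filling M n t ->
  RPP la mu (rpp_of t) /\ rpp_size (rpp_of t) = n.
Proof.
move=> /andP[/asboolP[t0 tm] /eqP <-]; split.
  move=> x y xy; rewrite !ffunE; have := valP x; have := valP y.
  rewrite !in_fsetD => /andP[_ yU] /andP[_ xU]; apply: tm => //.
  by move: xy; cell_lia.
rewrite /rpp_size; under eq_bigr do rewrite ffunE.
rewrite -(big_seq_fsetE _ _ predT (fun u => ev t u)) /=.
apply: big_fset_incl => [|u uU]; first exact: fsubsetDl.
by rewrite in_fsetD uU andbT negbK => /t0.
Qed.

Lemma RPP_rpp_of n (f : {ffun Defs.skew la mu -> nat}) : RPP la mu f -> rpp_size f = n ->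
  exists2 t : {ffun U -> 'I_n.+1}, rpp_filling M n t & f = rpp_of t.
Proof.
move=> fR fn.
have fle x : (f x <= n)%N by rewrite -fn /rpp_size (bigD1 x) //= leq_addr.
pose g u := oapp f 0%N (insub u).
have gval (x : Defs.skew la mu) : g (val x) = f x by rewrite /g valK.
have g0 u : u \notin Defs.skew la mu -> g u = 0%N by move=> us; rewrite /g insubN.
have gle u : (g u <= n)%N by rewrite /g; case: insub => /=.
have eg u : ev (fill U n g) u = g u.
  have [uU|nU] := boolP (u \in U); first by rewrite ev_fill.
  by rewrite ev_out // g0 // in_fsetD (negPf nU) andbF.
have ef : f = rpp_of (fill U n g).
  by apply/ffunP => x; rewrite ffunE eg gval.
exists (fill U n g) => //; apply/andP; split; last first.
  rewrite -[X in _ == X]fn [X in rpp_size X]ef /rpp_size; under [X in _ == X]eq_bigr do rewrite ffunE.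
  rewrite -(big_seq_fsetE _ _ predT (fun u => ev _ u)) /=; apply/eqP/esym.
  apply: big_fset_incl => [|u uU nu]; first exact: fsubsetDl.
  by rewrite eg g0.
apply/asboolP; split=> [u uM|u v uU vU uv]; rewrite !eg.
  by rewrite g0 // in_fsetD uM.
have [us|/g0->//] := boolP (u \in Defs.skew la mu).
have nuM : u \notin M by move: us; rewrite in_fsetD => /andP[].
have pu := proj1 iU u uU; have pv := proj1 iU v vU.
have inS w : w \in U -> cell_le u w -> w \in Defs.skew la mu.
  move=> wU uw; rewrite in_fsetD wU andbT; apply: contra nuM => wM.
  exact: (proj2 iM) wM pu uw.
(* Monotonicity is given along rows and columns only, so [u] and [v] are compared through the cell
   (u.1, v.2), which lies in the skew shape. *)
have cU : (u.1, v.2) \in U by apply: (proj2 iU) vU _ _; cell_lia.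
have cS : (u.1, v.2) \in Defs.skew la mu by apply: inS => //; cell_lia.
have vS := inS v vU uv.
apply: (@leq_trans (g (u.1, v.2))).
  rewrite (gval [` us]%fset) (gval [` cS]%fset); apply: fR => /=; cell_lia.
rewrite (gval [` cS]%fset) (gval [` vS]%fset); apply: fR => /=; cell_lia.
Qed.

Lemma rpp_of_inj N n : {in rpp_filling M n &, injective (@rpp_of N)}.
Proof.
move=> t t' /andP[/asboolP[t0 _] _] /andP[/asboolP[t'0 _] _] e.
apply: ev_inj => u uU; have [uM|nM] := boolP (u \in M); first by rewrite t0 // t'0.
have us : u \in Defs.skew la mu by rewrite in_fsetD uU nM.
by have := congr1 (fun f : {ffun Defs.skew la mu -> nat} => f [` us]%fset) e; rewrite !ffunE.
Qed.

Lemma fps_coef_rpp n :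
  fps_coef (fps_sum (RPP la mu) (fun pi => 'q ^+ rpp_size pi)) n =
  rpp_count U n n M.
Proof.
(* The list of reverse plane partitions of size [n], the only ones contributing to this
   coefficient. *)
pose r := [seq rpp_of t | t <- enum (rpp_filling M n : pred {ffun U -> 'I_n.+1})].
rewrite /= (fsbigE r).
- rewrite big_map big_enum_cond /rpp_count; apply: eq_big => [t|t Pt].
    apply: andb_idr => Pt; apply/asboolP; by have [] := rpp_of_RPP Pt.
  by have [_ ->] := rpp_of_RPP (andP Pt).1; rewrite fps_coefqX eqxx.
- rewrite map_inj_in_uniq ?enum_uniq // => t t'; rewrite !mem_enum; exact: rpp_of_inj.
- move=> f /= /mapP[t]; rewrite mem_enum => Pt ->; by have [] := rpp_of_RPP Pt.
move=> f fR nr; rewrite fps_coefqX; case: eqP => // en; case/negP: nr.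
have [t Pt ->] := RPP_rpp_of fR (esym en).
by apply/mapP; exists t; rewrite ?mem_enum.
Qed.

End RPPSeries.

(** * The hook weights *)

Lemma fps_qX_inj (R : comNzRingType) k (f g : fps R) :
  fps_q R ^+ k * f = fps_q R ^+ k * g -> f = g.
Proof.
move=> e; apply: fpsP => n; have := congr1 (fun f => fps_coef f (n + k)) e.
by rewrite !fps_coef_qXM ltnNge leq_addl /= addnK.
Qed.

(** Here [b] is the length of row i and [a] that of column j. Since i <= a and j <= b, the
    subtraction in [hook] is not truncated. *)
Lemma hookE la i j a b : is_partition la ->
  (i, j) \in young la -> (i, b) \in young la -> (i, b.+1) \notin young la ->
  (a, j) \in young la -> (a.+1, j) \notin young la ->
  (hook la (i, j) + (i + j) = b + a + 1)%N.
Proof.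
move=> pla; rewrite !mem_young /= => /and3P[i0 j0 jl] /and3P[_ b0 bl].
rewrite i0 /= -ltnNge ltnS => bl' /and3P[a0 _ jla]; rewrite j0 /= -ltnNge => jla'.
have eb : part la i = b by apply/eqP; rewrite eqn_leq bl' bl.
have ea : part (conj_part la) j = a.
  rewrite part_conj // -[la](cat_take_drop a) count_cat.
  have asz : (a <= size la)%N.
    rewrite leqNgt; apply/negP => lt.
    have e : part la a = 0%N by rewrite /part nth_default // -ltnS prednK.
    by move: jla; rewrite e leqNgt j0.
  have /eqP -> : count (leq j) (take a la) == size (take a la).
    rewrite -all_count; apply/allP => x /(nthP 0%N)[k].
    rewrite size_takel // => ka <-; rewrite nth_take //.
    by apply: leq_trans jla _; apply: (@part_sorted la k.+1 a).
  rewrite size_takel // [X in (_ + X)%N](_ : _ = 0%N) ?addn0 //.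
  apply/eqP; rewrite -leqn0 leqNgt -has_count; apply/hasPn => x /(nthP 0%N)[k _ <-].
  rewrite nth_drop -ltnNge; apply: leq_ltn_trans jla'.
  by apply: (@part_sorted la a.+1 (a + k).+1) => //; rewrite ltnS leq_addr.
have ib : (j <= b)%N by rewrite -eb.
have ia : (i <= a)%N.
  rewrite leqNgt; apply/negP => ai; have := part_sorted pla ai.
  by rewrite leqNgt (leq_trans jla' jl).
by rewrite /hook /= eb ea subnK; lia.
Qed.

Section Final.
Variable la : seq nat.
Hypothesis hla : is_partition la.
Let U := young la.
Let iU : ideal U := young_ideal hla.
Let N := (\sum_(u <- U) (u.1 + u.2))%N.
Let w (u : cell) : fps int := 'q ^+ hook la u.
(** The label q^(N - x): the ratio of two labels is a power of q whose exponent is the hook length.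
    [N] is large enough for N - x to be nonnegative at the positions that occur. *)
Let tau (x : int) : fps int := 'q ^+ `|N%:Z - x|%N.
Local Notation Z := (@excited_sum U N (fps int) w).
Local Notation K := (@row_weight (fps int) N tau).

Let bound u : u \in U -> (u.1 + u.2 <= N)%N.
Proof. by move=> uU; rewrite /N (big_fsetD1 u uU) /= leq_addr. Qed.
Let bound1 u : u \in U -> (u.1 <= N)%N.
Proof. by move=> /bound; apply: leq_trans; apply: leq_addr. Qed.

Lemma hook_edge_labelling : edge_labelling w U tau.
Proof.
move=> i j a b ijU ibU ib1 ajU aj1; rewrite /w /tau -exprD; congr (_ ^+ _).
have := hookE hla ijU ibU ib1 ajU aj1.
have := bound ijU; have := bound ibU; have := proj1 iU _ ajU; rewrite /cell_pos /=; lia.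
Qed.

(** Each added cell moves one vertical step up by one position, which divides [K] by q. *)
Lemma row_weight_card A : ideal A -> {subset A <= U} -> K A * 'q ^+ #|` A| = K fset0.
Proof.
have [n] := ubnP #|` A|; elim: n => // n IH in A * => lt iA AU.
have [->|nA0] := eqVneq A fset0; first by rewrite cardfs0 mulr1.
have [v rv] := ex_removable iA nA0; have [vA iAv] := rv.
have vU := AU v vA.
have [X [e1 e2 _ _]] := row_weight_addable tau iAv (removable_addable iA rv) (bound1 vU).
rewrite fsetD1K // in e2; have cA := cardfsD1 v A; rewrite vA in cA.
rewrite -(IH (A `\ v)%fset) //; last first.
- by move=> u; rewrite in_fsetD1 => /andP[_ /AU].
- by rewrite cA in lt.
rewrite e2 e1 cA exprS.
have -> : tau (content v - 1) = tau (content v) * 'q.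
  rewrite /tau -exprSr; congr (_ ^+ _); have := bound vU; rewrite /content; cell_lia.
ring.
Qed.

Lemma excited_sum_rec M : ideal M -> {subset M <= U} ->
  Z U M = \sum_(A <- fpowerset U | ideal_over M A) 'q ^+ #|` (U `\` A)%fset| * Z U A.
Proof.
(* A power of q can be cancelled although it need not be invertible as a power series. *)
move=> iM MU; have [E KE] : exists E, K fset0 = 'q ^+ E.
  by eexists; rewrite /row_weight /tau prodrXr.
apply: (@fps_qX_inj _ E); rewrite -KE -[in LHS](row_weight_card iU) //.
rewrite mulrAC (expansion iU bound1 iU _ hook_edge_labelling) // big_distrl big_distrr /=.
rewrite big_seq_cond [RHS]big_seq_cond; apply: eq_bigr => A.
rewrite fpowersetE => /andP[AU /andP[/asboolP iA _]].
rewrite -(row_weight_card iA (fsubsetP AU)).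
have -> : #|` U| = (#|` (U `\` A)%fset| + #|` A|)%N.
  by rewrite (cardfsDS AU) subnK // fsubset_leq_card.
rewrite exprD; ring.
Qed.

Lemma excited_sum_full : Z U U = \prod_(u <- U) (1 - w u).
Proof.
have e0 u : ev (fill U N (fun=> 0%N)) u = 0%N.
  by have [uL|nL] := boolP (u \in U); [rewrite ev_fill | rewrite ev_out].
have E (t : {ffun U -> 'I_N.+1}) : `[< excited_filling U U t >] = (t == fill U N (fun=> 0%N)).
  apply/asboolP/eqP => [[_ tm tU]|->]; last first.
    split=> [u _|u v _ _ _|u uU]; rewrite ?e0 //.
    by rewrite /shift !addn0 -surjective_pairing.
  apply: ev_inj => u uU; rewrite e0; apply/eqP; rewrite -leqn0 leqNgt; apply/negP => tu.
  (* A moved cell lands on a cell of [U] that must itself have moved at least as far; iterating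
     leads below every row. *)
  have [v [vU _ lt]] : exists v, [/\ v \in U, (0 < ev t v)%N & (N < v.1)%N].
    elim: N.+1 => [|k [v [vU tv kv]]]; first by exists u.
    exists (shift v (ev t v)); split; [exact: tU| |by cell_lia].
    by apply: leq_trans tv _; apply: tm => //; [exact: tU | cell_lia].
  by have := bound1 vU; rewrite leqNgt lt.
rewrite /excited_sum (eq_bigl _ _ E) big_pred1_eq; apply: eq_bigr => u _.
rewrite /cell_weight !e0 big_geq // mulr1 /shift !addn0 -surjective_pairing //.
Qed.

Definition skew_series (M : {fset cell}) : fps int :=
  Z U M * \prod_(u <- U) (1 - w u)^-1.

Let w_unit u : u \in U -> 1 - w u \is a GRing.unit.
Proof. by move=> uU; apply: unit_1BqX; apply: hook_gt0. Qed.

Lemma skew_series_full : skew_series U = 1.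
Proof.
rewrite /skew_series excited_sum_full -big_split /= big_seq big1 // => u uU.
by rewrite divrr // w_unit.
Qed.

Lemma skew_series_rec M : ideal M -> {subset M <= U} ->
  skew_series M =
  \sum_(A <- fpowerset U | ideal_over M A) 'q ^+ #|` (U `\` A)%fset| * skew_series A.
Proof.
move=> iM MU; rewrite /skew_series excited_sum_rec // big_distrl /=.
by apply: eq_bigr => A _; rewrite mulrA.
Qed.

Lemma fps_coef_sum (I : Type) (s : seq I) (P : pred I) (F : I -> fps int) n :
  fps_coef (\sum_(i <- s | P i) F i) n = \sum_(i <- s | P i) fps_coef (F i) n.
Proof. by apply: (big_morph (fun f : fps int => fps_coef f n)). Qed.

(** Both sides satisfy the same recursion. The term A = U is known explicitly, and in every other
    term the degree drops by the positive number of cells off [A], so induction on n applies for all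
    [M] at once. *)
Lemma fps_coef_skew_series n B M : (n <= B)%N -> ideal M -> {subset M <= U} ->
  fps_coef (skew_series M) n = rpp_count U B n M.
Proof.
elim/ltn_ind: n M => n IH M nB iM MU.
rewrite skew_series_rec // fps_coef_sum rpp_count_rec //.
rewrite big_seq_cond [RHS]big_seq_cond; apply: eq_bigr => A.
rewrite fpowersetE => /andP[AU /andP[/asboolP iA _]].
rewrite fps_coef_qXM; case: leqP => // cn.
have [->|nAU] := eqVneq A U.
  by rewrite skew_series_full rpp_count_full.
have c0 : (0 < #|` (U `\` A)%fset|)%N.
  rewrite cardfs_gt0; apply: contra nAU => /eqP/eqP; rewrite fsetD_eq0 => UA.
  by rewrite eqEfsubset AU UA.
apply: IH => //; [lia | lia | exact: fsubsetP].
Qed.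

(** Excited diagrams are reindexed by excited fillings. The factors 1 - w over the final positions
    cancel the part of the full denominator indexed by D, leaving the product over the complement,
    and the peak factors multiply to the power of q. *)
Lemma excited_series mu : is_partition mu -> (young mu `<=` U)%fset ->
  \sum_(D <- excited_diagrams la mu)
    'q ^+ peak_weight la mu D * \prod_(u <- (U `\` D)%fset) (1 / (1 - w u)) =
  skew_series (young mu).
Proof.
move=> hmu hsub; have iM := young_ideal hmu; have MU := fsubsetP hsub.
rewrite (big_seq_reindex (s := index_enum {ffun U -> 'I_N.+1})
  (P := fun t => `[< excited_filling U (young mu) t >]) (h := @diagram la mu N));
  rewrite ?fset_uniq ?index_enum_uniq //; first last.
- move=> D /(mem_excited_diagrams _ hsub) eD _.
  have [t vt ->] := filling_of_excited iM MU bound1 eD.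
  by exists t; split=> //; apply/asboolP.
- move=> t _ /asboolP vt; split=> //; apply/mem_excited_diagrams => //.
  have := peaks_of_filling iU iM MU vt; elim=> [|D P u _ eD au]; first exact: excited_start.
  exact: excited_step.
- by move=> t t' /andP[/asboolP vt _] /andP[/asboolP vt' _]; apply: diagram_inj.
rewrite /skew_series big_distrl /=; apply: eq_bigr => t /asboolP vt.
have pk := peaks_of_filling iU iM MU vt.
have eD : excited la mu (diagram mu t).
  by elim: pk => [|D P u _ eD au]; [exact: excited_start | exact: excited_step].
have DU := excited_sub hsub eD.
have -> : \prod_(u <- U) (1 - w u)^-1 =
    \prod_(u <- diagram mu t) (1 - w u)^-1 *
    \prod_(u <- (U `\` diagram mu t)%fset) (1 - w u)^-1.
  rewrite (big_fsetID _ (mem (diagram mu t))) /=; congr (_ * _); congr (\prod_(u <- enum_fset _) _).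
    apply/fsetP => u; rewrite !inE /= andb_idl //; exact: (fsubsetP DU).
  by apply/fsetP => u; rewrite !inE /= andbC.
rewrite mulrA; congr (_ * _); last by apply: eq_bigr => u _; rewrite div1r.
rewrite big_imfset /=; last by move=> u v uM vM; apply: diagram_inj_cell vt uM vM.
have -> : 'q ^+ peak_weight la mu (diagram mu t) =
    \prod_(v <- young mu) \prod_(low t v <= s < ev t v) w (shift v s).
  rewrite /peak_weight (peaks_inj (excited_peaksP eD) pk) expr_sum.
  rewrite (perm_big (peak_seq mu t)) /=; first exact: big_allpairs_dep.
  apply: uniq_perm; rewrite ?fset_uniq ?(peak_seq_uniq iM vt) // => u.
  by rewrite !inE.
rewrite -big_split /= big_seq [RHS]big_seq; apply: eq_bigr => v vM.
rewrite /cell_weight mulrAC divrr ?mul1r // w_unit //; have [_ _] := vt; exact.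
Qed.

End Final.

Theorem corollary6p17 (la mu : seq nat) (hla : is_partition la)
  (hmu : is_partition mu) (hsub : (young mu `<=` young la)%fset) :
  fps_sum (RPP la mu) (fun pi => 'q ^+ rpp_size pi) =
  \sum_(D <- excited_diagrams la mu)
    'q ^+ peak_weight la mu D *
    \prod_(u <- (young la `\` D)%fset) (1 / (1 - 'q ^+ hook la u)).
Proof.
apply: fpsP => n; rewrite (excited_series hla hmu hsub) fps_coef_rpp //.
apply/esym/fps_coef_skew_series => //; first exact: young_ideal.
exact/fsubsetP.
Qed.
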